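(* Up to rigid motions of $\mathbb{L}^3$, the only Riemann ZMC examples foliated by spacelike circles with constant radii contained in timelike planes are parametrized by $$X(x,v)=r^2x(0,\vec a)+(x,r\sinh v,r\cosh v),$$ where $x,v\in\mathbb{R}$, $\vec a\in\mathbb{R}^2\setminus\{0\}$ and $r>0$ is the radius of the circles. The surfaces are timelike except at the points satisfying $\langle\vec a,(\cosh v,\sinh v)\rangle=0$, which form a lightlike straight line.
   Context: $\mathbb{L}^3$ is $\mathbb{R}^3$ with the metric $\langle,\rangle=dx_1^2+dx_2^2-dx_3^2$; $\mathbb{R}^2$ is identified with the $x_2x_3$-plane, on which $\langle,\rangle=dx_2^2-dx_3^2$. A surface or plane is spacelike, timelike or lightlike where the induced metric is Riemannian, Lorentzian or degenerate; a straight line is lightlike if its direction $\vec v\ne0$ satisfies $\langle\vec v,\vec v\rangle=0$. The mean curvature $H$ is defined where the induced metric of a surface is non-degenerate; zero mean curvature (ZMC) means $H=0$. A circle is a non-degenerate planar curve of nonzero constant curvature; a spacelike circle in a plane $x_1=\text{const}$ is a hyperbola $s\mapsto p+r(0,\sinh s,\cosh s)$ with center $p$ and radius $r>0$. A Riemann ZMC example is a non-rotational surface with zero mean curvature foliated by pieces of circles contained in parallel planes; after a rigid motion (isometry of $\mathbb{L}^3$) the planes are taken parallel to $x_1=0$.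
   Formalization: The parametrized surface has zero mean curvature only when r^4<a,a> = -1 (e.g. a=(1,0) fails), so the converse and the causal description are stated only for those a, and this condition is proved necessary and sufficient. *)

(* Defs.v *)
From Stdlib Require Import Reals.
From Coquelicot Require Import Coquelicot.
Open Scope R_scope.

Definition L3 : Type := (R * R * R)%type.

Definition x1 (p : L3) : R := fst (fst p).
Definition x2 (p : L3) : R := snd (fst p).
Definition x3 (p : L3) : R := snd p.

Definition zero3 : L3 := (0, 0, 0).
Definition add3 (p q : L3) : L3 := (x1 p + x1 q, x2 p + x2 q, x3 p + x3 q).
Definition scal3 (k : R) (p : L3) : L3 := (k * x1 p, k * x2 p, k * x3 p).

Definition lor (p q : L3) : R := x1 p * x1 q + x2 p * x2 q - x3 p * x3 q.

(** The plane R^2 is the x2x3-plane with the metric induced by [lor]. *)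
Definition emb (a : R * R) : L3 := (0, fst a, snd a).
Definition lor2 (a b : R * R) : R := lor (emb a) (emb b).

(** Lorentzian cross product, characterised by
    [lor (cross p q) w = det (p, q, w)]; hence the sign of the last entry. *)
Definition cross (p q : L3) : L3 :=
  (x2 p * x3 q - x3 p * x2 q,
   x3 p * x1 q - x1 p * x3 q,
   - (x1 p * x2 q - x2 p * x1 q)).

(** Isometries of L^3, with no restriction on orientation or time-orientation. *)
Definition linear_isometry (A : L3 -> L3) : Prop :=
  (forall p q, A (add3 p q) = add3 (A p) (A q)) /\
  (forall k p, A (scal3 k p) = scal3 k (A p)) /\
  (forall p q, lor (A p) (A q) = lor p q).

Definition rigid_motion (Phi : L3 -> L3) : Prop :=
  exists (A : L3 -> L3) (b : L3),
    linear_isometry A /\ forall p, Phi p = add3 (A p) b.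

Definition lightlike_line (S : L3 -> Prop) : Prop :=
  exists p d : L3, d <> zero3 /\ lor d d = 0 /\
    forall q, S q <-> exists s : R, q = add3 p (scal3 s d).

(** Causal character of a two-dimensional linear subspace [T]. *)
Definition degenerate (T : L3 -> Prop) : Prop :=
  exists w, T w /\ w <> zero3 /\ forall w', T w' -> lor w w' = 0.

Definition orthonormal_frame (e1 e2 : L3) : Prop :=
  lor e1 e1 = 1 /\ lor e2 e2 = -1 /\ lor e1 e2 = 0.

Definition lorentzian (T : L3 -> Prop) : Prop :=
  exists e1 e2, T e1 /\ T e2 /\ orthonormal_frame e1 e2.

(** A surface is a C^2 immersion [X] of a connected open set [D] of R^2;
    the values of [X] outside [D] are irrelevant. *)

Definition connected (D : R * R -> Prop) : Prop :=
  forall U V : R * R -> Prop,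
    open U -> open V ->
    (forall p, D p -> U p \/ V p) ->
    (forall p, D p -> ~ (U p /\ V p)) ->
    (exists p, D p /\ U p) -> ~ (exists p, D p /\ V p).

Definition partial1 (f : R -> R -> R) (u v : R) : R := Derive (fun s => f s v) u.
Definition partial2 (f : R -> R -> R) (u v : R) : R := Derive (fun s => f u s) v.

Definition C1_on (D : R * R -> Prop) (f : R -> R -> R) : Prop :=
  forall u v, D (u, v) ->
    ex_derive (fun s => f s v) u /\ ex_derive (fun s => f u s) v /\
    continuity_2d_pt (partial1 f) u v /\ continuity_2d_pt (partial2 f) u v.

Definition C2_on (D : R * R -> Prop) (f : R -> R -> R) : Prop :=
  C1_on D f /\ C1_on D (partial1 f) /\ C1_on D (partial2 f).

Definition du (X : R -> R -> L3) (u v : R) : L3 :=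
  (partial1 (fun s t => x1 (X s t)) u v,
   partial1 (fun s t => x2 (X s t)) u v,
   partial1 (fun s t => x3 (X s t)) u v).

Definition dv (X : R -> R -> L3) (u v : R) : L3 :=
  (partial2 (fun s t => x1 (X s t)) u v,
   partial2 (fun s t => x2 (X s t)) u v,
   partial2 (fun s t => x3 (X s t)) u v).

Definition immersion (D : R * R -> Prop) (X : R -> R -> L3) : Prop :=
  C2_on D (fun u v => x1 (X u v)) /\
  C2_on D (fun u v => x2 (X u v)) /\
  C2_on D (fun u v => x3 (X u v)) /\
  forall u v, D (u, v) -> forall a b : R,
    add3 (scal3 a (du X u v)) (scal3 b (dv X u v)) = zero3 -> a = 0 /\ b = 0.

Definition surface (D : R * R -> Prop) (X : R -> R -> L3) : Prop :=
  open D /\ connected D /\ immersion D X.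

Definition tangent_plane (X : R -> R -> L3) (u v : R) (w : L3) : Prop :=
  exists a b : R, w = add3 (scal3 a (du X u v)) (scal3 b (dv X u v)).

Definition timelike_at (X : R -> R -> L3) (u v : R) : Prop :=
  lorentzian (tangent_plane X u v).
Definition lightlike_at (X : R -> R -> L3) (u v : R) : Prop :=
  degenerate (tangent_plane X u v).

(** Meaningful only at points where the induced metric is non-degenerate. *)
Definition unit_normal (X : R -> R -> L3) (u v : R) : L3 :=
  let n := cross (du X u v) (dv X u v) in
  scal3 (/ sqrt (Rabs (lor n n))) n.

Definition mean_curvature (X : R -> R -> L3) (u v : R) : R :=
  let E := lor (du X u v) (du X u v) in
  let F := lor (du X u v) (dv X u v) in
  let G := lor (dv X u v) (dv X u v) in
  let N := unit_normal X u v in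
  let e := lor N (du (du X) u v) in
  let f := lor N (dv (du X) u v) in
  let g := lor N (dv (dv X) u v) in
  lor N N * ((e * G - 2 * f * F + g * E) / (2 * (E * G - F * F))).

Definition ZMC (D : R * R -> Prop) (X : R -> R -> L3) : Prop :=
  forall u v, D (u, v) -> ~ lightlike_at X u v -> mean_curvature X u v = 0.

(** The rotations about a line form a one-dimensional group; its identity
    component is, up to rescaling the parameter, the only nontrivial
    one-parameter group of motions fixing the line pointwise, whatever the causal character of the line. *)
Definition rotation_group (p d : L3) (Phi : R -> L3 -> L3) : Prop :=
  (forall s, rigid_motion (Phi s)) /\
  (forall s t q, Phi (s + t) q = Phi s (Phi t q)) /\
  (forall q s, continuous (fun s => x1 (Phi s q)) s /\
               continuous (fun s => x2 (Phi s q)) s /\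
               continuous (fun s => x3 (Phi s q)) s) /\
  (exists s q, Phi s q <> q) /\
  (forall s k, Phi s (add3 p (scal3 k d)) = add3 p (scal3 k d)).

(** Surfaces here may be pieces of larger ones, so invariance under the
    rotations is only required for small parameters at each point. *)
Definition rotational (D : R * R -> Prop) (X : R -> R -> L3) : Prop :=
  exists (p d : L3) (Phi : R -> L3 -> L3),
    d <> zero3 /\ rotation_group p d Phi /\
    forall u v, D (u, v) -> exists eps : R, 0 < eps /\
      forall s, Rabs s < eps ->
        exists u' v', D (u', v') /\ X u' v' = Phi s (X u v).

(** The spacelike circle of center [p] and radius [r] in the timelike plane
    through [p] spanned by the orthonormal frame [e1, e2].  For
    [e1 = (0,1,0)], [e2 = (0,0,1)] it is [p + r (0, sinh s, cosh s)]; every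
    other one is congruent to this. *)
Definition spacelike_circle (e1 e2 p : L3) (r s : R) : L3 :=
  add3 p (scal3 r (add3 (scal3 (sinh s) e1) (scal3 (cosh s) e2))).

(** All leaves [u = const] have radius [r] and lie in planes parallel to
    span(e1, e2); [c] is the curve of centers.  The arc of each circle which
    is covered is given by the slices of [D]. *)
Definition foliated_by_spacelike_circles
    (r : R) (D : R * R -> Prop) (X : R -> R -> L3) : Prop :=
  exists (e1 e2 : L3) (c : R -> L3), orthonormal_frame e1 e2 /\
    forall u v, D (u, v) -> X u v = spacelike_circle e1 e2 (c u) r v.

Definition Riemann_ZMC_example
    (r : R) (D : R * R -> Prop) (X : R -> R -> L3) : Prop :=
  surface D X /\ foliated_by_spacelike_circles r D X /\
  ZMC D X /\ ~ rotational D X.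

Definition whole_plane : R * R -> Prop := fun _ => True.

Definition model (a : R * R) (r : R) (x v : R) : L3 :=
  add3 (scal3 (r ^ 2 * x) (emb a)) (x, r * sinh v, r * cosh v).

(* Main.v *)
(** Write the leaf over [u] as [c u + r (sinh v e1 + cosh v e2)] and let [g] be the curve of
    centers [c] in the coordinates given by [cross e1 e2, e1, e2].  Along a leaf the equation
    [H = 0] is a linear relation between [1], [sinh v] and [cosh v], so it splits into
    [g1'' g2' = g1' g2''], [g1'' g3' = g1' g3''] and [g1' (g1'^2 + g2'^2 - g3'^2) = 0].
    By connectedness [g1'] vanishes identically or nowhere.  In the first case the
    surface lies in a timelike plane and is invariant under the boosts of that plane, which
    is excluded; in the second one [g'] has a constant lightlike direction, and the surface is a
    cylinder with lightlike rulings over a hyperbola, with [r^4 <a, a> = -1].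

    The model is not rotational.  It is a sheet of [phip * phim = r^2] for two linear functionals
    [phip], [phim] vanishing on the rulings.  A rigid motion near the identity of a rotation group
    maps finitely many given points of the sheet into it, which is enough to see that it
    preserves the pair [{phip, phim}] up to factors; its square is then trivial modulo the
    rulings, and having a fixed point it is the identity. *)

Require Import Defs.
From Stdlib Require Import Reals Lra List Ranalysis5.
From Stdlib Require Import Classical ClassicalEpsilon.
From Stdlib Require Import PropExtensionality FunctionalExtensionality.
From Coquelicot Require Import Coquelicot.
Import ListNotations.
Open Scope R_scope.

(** * Calculus and connectedness *)

Lemma open_box (D : R * R -> Prop) (u v : R) :
  open D -> D (u, v) ->
  exists d : posreal, forall s t,
    Rabs (s - u) < d -> Rabs (t - v) < d -> D (s, t).
Proof.
  intros HD Hp. destruct (HD _ Hp) as [d Hd].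
  exists d. intros s t Hs Ht. apply Hd. split; assumption.
Qed.

Lemma open_slice1 (D : R * R -> Prop) (u v : R) :
  open D -> D (u, v) -> locally u (fun s => D (s, v)).
Proof.
  intros HD Hp. destruct (open_box D u v HD Hp) as [d Hd].
  exists d. intros s Hs. apply Hd; [exact Hs|].
  rewrite Rminus_diag, Rabs_R0. apply cond_pos.
Qed.

Lemma open_slice2 (D : R * R -> Prop) (u v : R) :
  open D -> D (u, v) -> locally v (fun t => D (u, t)).
Proof.
  intros HD Hp. destruct (open_box D u v HD Hp) as [d Hd].
  exists d. intros t Ht. apply Hd; [|exact Ht].
  rewrite Rminus_diag, Rabs_R0. apply cond_pos.
Qed.

Lemma constant_of_derive_zero (f : R -> R) (a b : R) :
  (forall t, Rmin a b <= t <= Rmax a b -> is_derive f t 0) -> f a = f b.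
Proof.
  intros H.
  destruct (MVT_gen f a b (fun _ => 0)) as [c [_ Hc]]; [| |lra].
  - intros x Hx. apply H. lra.
  - intros x Hx. apply continuity_pt_filterlim.
    apply (ex_derive_continuous f x). exists 0. apply H, Hx.
Qed.

Lemma locally_constant_of_derive_zero (f : R -> R) (u : R) :
  locally u (fun s => is_derive f s 0) -> locally u (fun s => f s = f u).
Proof.
  intros [d Hd]. exists d. intros s Hs.
  apply constant_of_derive_zero. intros t Ht. apply Hd.
  change (Rabs (t - u) < d). change (Rabs (s - u) < d) in Hs.
  apply Rle_lt_trans with (2 := Hs).
  revert Ht. unfold Rmin, Rmax, Rabs.
  repeat (destruct Rle_dec || destruct Rcase_abs); lra.
Qed.

Lemma locally_neq_zero (g : R -> R) (u : R) :
  continuous g u -> g u <> 0 -> locally u (fun s => g s <> 0).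
Proof.
  intros Hc H0. apply (Hc (fun y => y <> 0)).
  exists (mkposreal _ (Rabs_pos_lt _ H0)). intros y Hy Hy0.
  change (Rabs (y - g u) < Rabs (g u)) in Hy.
  rewrite Hy0, Rminus_0_l, Rabs_Ropp in Hy. lra.
Qed.

(** The third hypothesis is a vanishing Wronskian, the numerator of the derivative of [f / g], so
    this quotient is constant near [u], where [g] stays nonzero. *)
Lemma locally_ratio_constant (f g : R -> R) (u : R) :
  locally u (fun s => ex_derive f s) -> locally u (fun s => ex_derive g s) ->
  locally u (fun s => Derive f s * g s = f s * Derive g s) ->
  g u <> 0 ->
  locally u (fun s => f s = f u / g u * g s).
Proof.
  intros Hf Hg Hw H0.
  assert (Hg0 : locally u (fun s => g s <> 0)).
  { apply locally_neq_zero; [|exact H0].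
    apply (ex_derive_continuous g u), (locally_singleton _ _ Hg). }
  assert (Hc : locally u (fun s => f s / g s = f u / g u)).
  { apply (locally_constant_of_derive_zero (fun s => f s / g s)).
    generalize (filter_and _ _ Hf (filter_and _ _ Hg (filter_and _ _ Hw Hg0))).
    apply filter_imp. intros s [Fs [Gs [Ws Ns]]].
    replace 0 with ((Derive f s * g s - f s * Derive g s) / g s ^ 2)
      by (rewrite Ws; field; exact Ns).
    apply is_derive_div; trivial; apply Derive_correct; assumption. }
  generalize (filter_and _ _ Hc Hg0). apply filter_imp.
  intros s [Cs Ns]. rewrite <- Cs. field. exact Ns.
Qed.

(** The points of [D] where [k] takes the value [k p] and those where it does not form two open
    sets. [T] is arbitrary so that [k] may be real-valued or proposition-valued. *)
Lemma connected_locally_constant {T : Type} (D : R * R -> Prop) (k : R * R -> T) :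
  connected D ->
  (forall p, D p -> locally p (fun q => D q /\ k q = k p)) ->
  forall p q, D p -> D q -> k q = k p.
Proof.
  intros HD Hk p q Hp Hq. apply NNPP. intros Hn.
  refine (HD (fun q => D q /\ k q = k p) (fun q => D q /\ k q <> k p)
            _ _ _ _ _ _).
  - intros x [Dx Kx]. rewrite <- Kx. apply Hk, Dx.
  - intros x [Dx Kx]. generalize (Hk x Dx). apply filter_imp.
    intros y [Dy Ky]. rewrite Ky. auto.
  - intros x Dx. destruct (classic (k x = k p)); auto.
  - intros x _ [[_ A] [_ B]]. exact (B A).
  - exists p. auto.
  - exists q. auto.
Qed.

Lemma locally_fst (D : R * R -> Prop) (P : R -> Prop) (u v : R) :
  open D -> D (u, v) -> locally u P ->
  locally (u, v) (fun q => D q /\ P (fst q)).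
Proof.
  intros HD Hp [d Hd]. apply filter_and; [apply HD, Hp|].
  exists d. intros [s t] [Hs _]. apply Hd, Hs.
Qed.

Lemma connected_whole_plane : connected whole_plane.
Proof.
  intros U V HU HV Hc Hd [p [_ Up]] [q [_ Vq]].
  set (g := fun t : R =>
    (fst p + t * (fst q - fst p), snd p + t * (snd q - snd p))).
  assert (Hg : forall W : R * R -> Prop, open W -> open (fun t => W (g t))).
  { intros W HW. apply open_comp; [|exact HW]. intros t _.
    apply filterlim_locally. intros eps. unfold g, ball; simpl; unfold prod_ball; simpl.
    apply filter_and; revert eps; apply filterlim_locally;
      apply (ex_derive_continuous (fun t => _ + t * _)); auto_derive; trivial. }
  destruct (classic (U (g 1))) as [U1|U1].
  { apply (Hd q); [exact I|]. split; [|exact Vq].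
    replace q with (g 1); [exact U1|]. destruct q as [q1 q2]. unfold g; simpl.
    f_equal; ring. }
  assert (U0 : U (g 0)).
  { replace (g 0) with p; [exact Up|]. destruct p as [p1 p2]. unfold g; simpl.
    f_equal; ring. }
  (* Along the segment from [p] to [q] the indicator of [U] is locally constant, since [U] and [V]
     are open, disjoint and cover. Its derivative is zero everywhere, yet it is 1 at 0 and 0 at
     1. *)
  set (chi := fun t => if excluded_middle_informative (U (g t)) then 1 else 0).
  assert (Hchi : forall t, is_derive chi t 0).
  { intros t. destruct (excluded_middle_informative (U (g t))) as [Ut|Ut].
    - apply (is_derive_ext_loc (fun _ => 1)); [|apply (is_derive_const 1)].
      generalize (Hg U HU t Ut). apply filter_imp. intros s Us. unfold chi.
      destruct excluded_middle_informative; [reflexivity|contradiction].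
    - assert (Vt : V (g t)) by (destruct (Hc (g t) I); [contradiction|assumption]).
      apply (is_derive_ext_loc (fun _ => 0)); [|apply (is_derive_const 0)].
      generalize (Hg V HV t Vt). apply filter_imp. intros s Vs. unfold chi.
      destruct excluded_middle_informative; [|reflexivity].
      destruct (Hd (g s) I); auto. }
  assert (E : chi 0 = chi 1) by (apply constant_of_derive_zero; auto).
  unfold chi in E. repeat destruct excluded_middle_informative; try contradiction. lra.
Qed.

(** Regularity of [c] and [phi] is inherited from [f]: on a horizontal slice of [D], [c] is [f]
    minus a constant, and on a vertical slice so is [phi]. Openness of [D] makes the slices
    neighbourhoods. *)
Lemma derivatives_of_sum (D : R * R -> Prop) (f : R -> R -> R) (c phi : R -> R) :
  open D -> C2_on D f ->
  (forall u v, D (u, v) -> f u v = c u + phi v) ->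
  forall u v, D (u, v) ->
    ex_derive c u /\ ex_derive (Derive c) u /\
    partial1 f u v = Derive c u /\
    partial2 f u v = Derive phi v /\
    partial1 (partial1 f) u v = Derive (Derive c) u /\
    partial2 (partial1 f) u v = 0 /\
    partial2 (partial2 f) u v = Derive (Derive phi) v.
Proof.
  intros HD [H1 [H2 _]] Hf.
  assert (E1 : forall u v, D (u, v) ->
            locally u (fun s => f s v - phi v = c s)).
  { intros u v Hp. generalize (open_slice1 D u v HD Hp). apply filter_imp.
    intros s Hs. rewrite (Hf s v Hs). ring. }
  assert (E2 : forall u v, D (u, v) ->
            locally v (fun t => f u t = c u + phi t)).
  { intros u v Hp. generalize (open_slice2 D u v HD Hp). apply filter_imp.
    intros t Ht. apply (Hf u t Ht). }
  assert (P1 : forall u v, D (u, v) -> is_derive c u (partial1 f u v)).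
  { intros u v Hp. apply (is_derive_ext_loc _ _ _ _ (E1 u v Hp)).
    destruct (H1 u v Hp) as [K _]. apply Derive_correct in K.
    unfold partial1. rewrite <- (Rminus_0_r (Derive _ u)).
    apply @is_derive_minus; [exact K|apply (is_derive_const (phi v))]. }
  assert (Phi : forall u v, D (u, v) -> ex_derive phi v).
  { intros u v Hp. destruct (H1 u v Hp) as [_ [K _]].
    assert (E : locally v (fun t => f u t - c u = phi t)).
    { generalize (E2 u v Hp). apply filter_imp. intros t ->. ring. }
    apply (ex_derive_ext_loc _ _ _ E).
    apply @ex_derive_minus; [exact K|apply (ex_derive_const (c u))]. }
  assert (P2 : forall u v, D (u, v) -> partial2 f u v = Derive phi v).
  { intros u v Hp. transitivity (Derive (fun t => c u + phi t) v).
    { apply Derive_ext_loc, E2, Hp. }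
    rewrite Derive_plus; [|apply (ex_derive_const (c u))|apply (Phi u v Hp)].
    rewrite Derive_const. ring. }
  assert (Q1 : forall u v, D (u, v) -> partial1 f u v = Derive c u).
  { intros u v Hp. symmetry. apply is_derive_unique, P1, Hp. }
  assert (L1 : forall u v, D (u, v) ->
            locally u (fun s => partial1 f s v = Derive c s)).
  { intros u v Hp. generalize (open_slice1 D u v HD Hp). apply filter_imp.
    intros s. apply Q1. }
  intros u v Hp. repeat split.
  - exists (partial1 f u v). apply P1, Hp.
  - apply (ex_derive_ext_loc _ _ _ (L1 u v Hp)). apply (H2 u v Hp).
  - apply Q1, Hp.
  - apply P2, Hp.
  - apply Derive_ext_loc, L1, Hp.
  - unfold partial2 at 1. rewrite (Derive_ext_loc _ (fun _ => Derive c u)).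
    + apply Derive_const.
    + generalize (open_slice2 D u v HD Hp). apply filter_imp. intros t. apply Q1.
  - apply Derive_ext_loc. generalize (open_slice2 D u v HD Hp). apply filter_imp.
    intros t. apply P2.
Qed.

(** * Frames and the mean curvature of a foliated surface *)

Lemma lor_cross_cross (p q : L3) :
  lor (cross p q) (cross p q) = lor p q ^ 2 - lor p p * lor q q.
Proof. destruct p as [[p1 p2] p3], q as [[q1 q2] q3]. unfold lor, cross; cbn. ring. Qed.

Lemma lor_frame (e1 e2 p q : L3) :
  orthonormal_frame e1 e2 ->
  lor p q = lor p (cross e1 e2) * lor q (cross e1 e2)
            + lor p e1 * lor q e1 - lor p e2 * lor q e2.
Proof.
  intros [H1 [H2 H3]].
  (* Gram's identity for the basis [e1, e2, cross e1 e2]. *)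
  assert (G : (lor e1 e2 ^ 2 - lor e1 e1 * lor e2 e2) * lor p q =
    lor p (cross e1 e2) * lor q (cross e1 e2)
    - (lor p e1 * lor e2 e2 - lor p e2 * lor e1 e2) * lor q e1
    - (lor p e2 * lor e1 e1 - lor p e1 * lor e1 e2) * lor q e2).
  { destruct p as [[? ?] ?], q as [[? ?] ?], e1 as [[? ?] ?], e2 as [[? ?] ?].
    unfold lor, cross; cbn. ring. }
  rewrite H1, H2, H3 in G. lra.
Qed.

(** Coordinates in the basis [cross e1 e2, e1, e2]; the sign of the last one compensates
    [lor e2 e2 = -1]. *)
Definition frame_map (e1 e2 q : L3) : L3 :=
  (lor q (cross e1 e2), lor q e1, - lor q e2).

Lemma lor_add3 (p q w : L3) : lor (add3 p q) w = lor p w + lor q w.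
Proof. unfold lor, add3; cbn. ring. Qed.

Lemma lor_scal3 (k : R) (p w : L3) : lor (scal3 k p) w = k * lor p w.
Proof. unfold lor, scal3; cbn. ring. Qed.

Lemma linear_isometry_frame_map (e1 e2 : L3) :
  orthonormal_frame e1 e2 -> linear_isometry (frame_map e1 e2).
Proof.
  intros He. split; [|split].
  - intros p q. unfold frame_map. rewrite !lor_add3.
    unfold add3; cbn. f_equal; ring.
  - intros k p. unfold frame_map. rewrite !lor_scal3.
    unfold scal3; cbn. f_equal; ring.
  - intros p q. rewrite (lor_frame e1 e2 p q He).
    unfold frame_map, lor at 1; cbn. ring.
Qed.

Lemma lor_cross_frame_map (e1 e2 p q w : L3) :
  orthonormal_frame e1 e2 ->
  lor (cross (frame_map e1 e2 p) (frame_map e1 e2 q)) (frame_map e1 e2 w) =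
  lor (cross p q) w.
Proof.
  intros [H1 [H2 H3]].
  (* [lor (cross p q) w] is a determinant, so passing to frame coordinates multiplies it by the
     determinant of [frame_map], which is this square of the normal and equals 1. *)
  transitivity (lor (cross e1 e2) (cross e1 e2) * lor (cross p q) w).
  - destruct p as [[? ?] ?], q as [[? ?] ?], w as [[? ?] ?],
      e1 as [[? ?] ?], e2 as [[? ?] ?].
    unfold frame_map, lor, cross; cbn. ring.
  - rewrite lor_cross_cross, H1, H2, H3. ring.
Qed.

Lemma frame_map_combination (e1 e2 : L3) (a b : R) :
  orthonormal_frame e1 e2 ->
  frame_map e1 e2 (add3 (scal3 a e1) (scal3 b e2)) = (0, a, b).
Proof.
  intros [H1 [H2 H3]]. unfold frame_map.
  rewrite !lor_add3, !lor_scal3, H1, H2, H3.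
  replace (lor e2 e1) with 0 by (rewrite <- H3; unfold lor; ring).
  replace (lor e1 (cross e1 e2)) with 0 by (unfold lor, cross; cbn; ring).
  replace (lor e2 (cross e1 e2)) with 0 by (unfold lor, cross; cbn; ring).
  repeat f_equal; ring.
Qed.

Lemma cosh_sqr (v : R) : cosh v ^ 2 = 1 + sinh v ^ 2.
Proof.
  assert (H : exp v * exp (- v) = 1) by (rewrite <- exp_plus, Rplus_opp_r; apply exp_0).
  unfold cosh, sinh. lra.
Qed.

Definition gram (p q : L3) : R := lor p p * lor q q - lor p q ^ 2.

Lemma not_lightlike_of_gram (X : R -> R -> L3) (u v : R) :
  gram (du X u v) (dv X u v) <> 0 -> ~ lightlike_at X u v.
Proof.
  intros Hg [w [[a [b Hw]] [Hw0 Horth]]]. apply Hg.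
  set (p := du X u v) in *. set (q := dv X u v) in *.
  assert (Tp : tangent_plane X u v p).
  { exists 1, 0. fold p q. unfold add3, scal3. destruct p as [[? ?] ?]; cbn.
    repeat f_equal; ring. }
  assert (Tq : tangent_plane X u v q).
  { exists 0, 1. fold p q. unfold add3, scal3. destruct q as [[? ?] ?]; cbn.
    repeat f_equal; ring. }
  generalize (Horth p Tp) (Horth q Tq). rewrite Hw, !lor_add3, !lor_scal3.
  replace (lor q p) with (lor p q) by (unfold lor; ring). intros P Q.
  (* Cramer's rule: [a p + b q] is orthogonal to [p] and [q], so the determinant [gram p q]
     annihilates both coefficients. *)
  assert (Ha : a * gram p q = 0).
  { unfold gram. replace (a * _) with
      (lor q q * (a * lor p p + b * lor p q) - lor p q * (a * lor p q + b * lor q q))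
      by ring. rewrite P, Q. ring. }
  assert (Hb : b * gram p q = 0).
  { unfold gram. replace (b * _) with
      (lor p p * (a * lor p q + b * lor q q) - lor p q * (a * lor p p + b * lor p q))
      by ring. rewrite P, Q. ring. }
  apply Rmult_integral in Ha, Hb.
  destruct Ha as [Ha|]; [|assumption]. destruct Hb as [Hb|]; [|assumption].
  exfalso. apply Hw0. rewrite Hw, Ha, Hb. unfold add3, scal3, zero3; cbn.
  repeat f_equal; ring.
Qed.

(** The expression [e G - 2 f F + g E] with the normal left unnormalised. *)
Definition curvature_numerator (X : R -> R -> L3) (u v : R) : R :=
  let p := du X u v in
  let q := dv X u v in
  lor (cross p q) (du (du X) u v) * lor q q
  - 2 * lor (cross p q) (dv (du X) u v) * lor p q
  + lor (cross p q) (dv (dv X) u v) * lor p p.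

(** The equation holds at every point, so a vanishing numerator always gives [H = 0]; the converse
    requires [k <> 0], hence a nondegenerate metric. *)
Lemma mean_curvature_eq (X : R -> R -> L3) (u v : R) :
  exists k : R,
    (gram (du X u v) (dv X u v) <> 0 -> k <> 0) /\
    mean_curvature X u v = k * curvature_numerator X u v.
Proof.
  set (p := du X u v). set (q := dv X u v).
  set (m := / sqrt (Rabs (lor (cross p q) (cross p q)))).
  (* One factor [m] comes from the normal in [e, f, g], and [m ^ 2] times the square of the normal
     from [lor N N]. *)
  exists (m ^ 3 * lor (cross p q) (cross p q) / (2 * gram p q)). split.
  - intros Hg.
    assert (Hn : lor (cross p q) (cross p q) <> 0).
    { rewrite lor_cross_cross. unfold gram in Hg. lra. }
    assert (Hm : m <> 0).
    { apply Rinv_neq_0_compat, Rgt_not_eq, sqrt_lt_R0, Rabs_pos_lt, Hn. }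
    apply Rmult_integral_contrapositive_currified.
    + apply Rmult_integral_contrapositive_currified; [apply pow_nonzero|]; assumption.
    + apply Rinv_neq_0_compat. lra.
  - unfold mean_curvature, curvature_numerator, unit_normal. fold p q m.
    rewrite !lor_scal3.
    replace (lor (cross p q) (scal3 m (cross p q)))
      with (m * lor (cross p q) (cross p q)) by (unfold lor, scal3; cbn; ring).
    replace (lor p p * lor q q - lor p q * lor p q) with (gram p q)
      by (unfold gram; ring).
    unfold Rdiv. ring.
Qed.

Lemma ZMC_numerator (D : R * R -> Prop) (X : R -> R -> L3) (u v : R) :
  ZMC D X -> D (u, v) -> gram (du X u v) (dv X u v) <> 0 ->
  curvature_numerator X u v = 0.
Proof.
  intros HZ Hp Hg.
  generalize (HZ u v Hp (not_lightlike_of_gram X u v Hg)).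
  destruct (mean_curvature_eq X u v) as [k [Hk ->]]. intros H.
  apply Rmult_integral in H. destruct H as [H|H]; [|exact H].
  destruct (Hk Hg H).
Qed.

Definition velocity (c : R -> L3) (u : R) : L3 :=
  (Derive (fun s => x1 (c s)) u, Derive (fun s => x2 (c s)) u,
   Derive (fun s => x3 (c s)) u).

Definition differentiable (c : R -> L3) (u : R) : Prop :=
  ex_derive (fun s => x1 (c s)) u /\ ex_derive (fun s => x2 (c s)) u /\
  ex_derive (fun s => x3 (c s)) u.

Lemma Derive_hyperbolic (r a b v : R) :
  Derive (fun t => r * (sinh t * a + cosh t * b)) v =
  r * (cosh v * a + sinh v * b).
Proof. apply is_derive_unique. auto_derive; [trivial|]. ring. Qed.

Lemma Derive2_hyperbolic (r a b v : R) :
  Derive (Derive (fun t => r * (sinh t * a + cosh t * b))) v =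
  r * (sinh v * a + cosh v * b).
Proof.
  rewrite (Derive_ext _ (fun t => r * (sinh t * b + cosh t * a))).
  - rewrite Derive_hyperbolic. ring.
  - intros t. rewrite Derive_hyperbolic. ring.
Qed.

Lemma circle_foliation_derivatives (r : R) (e1 e2 : L3) (c : R -> L3)
    (D : R * R -> Prop) (X : R -> R -> L3) :
  surface D X ->
  (forall u v, D (u, v) -> X u v = spacelike_circle e1 e2 (c u) r v) ->
  forall u v, D (u, v) ->
    differentiable c u /\ differentiable (velocity c) u /\
    du X u v = velocity c u /\
    dv X u v = scal3 r (add3 (scal3 (cosh v) e1) (scal3 (sinh v) e2)) /\
    du (du X) u v = velocity (velocity c) u /\
    dv (du X) u v = zero3 /\
    dv (dv X) u v = scal3 r (add3 (scal3 (sinh v) e1) (scal3 (cosh v) e2)).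
Proof.
  intros [HD [_ [S1 [S2 [S3 _]]]]] HX u v Hp.
  assert (K := fun f c phi HS Hf => derivatives_of_sum D f c phi HD HS Hf u v Hp).
  destruct (K (fun u v => x1 (X u v)) (fun s => x1 (c s))
              (fun t => r * (sinh t * x1 e1 + cosh t * x1 e2)) S1)
    as [A1 [A2 [A3 [A4 [A5 [A6 A7]]]]]].
  { intros s t Hst. rewrite (HX s t Hst). reflexivity. }
  destruct (K (fun u v => x2 (X u v)) (fun s => x2 (c s))
              (fun t => r * (sinh t * x2 e1 + cosh t * x2 e2)) S2)
    as [B1 [B2 [B3 [B4 [B5 [B6 B7]]]]]].
  { intros s t Hst. rewrite (HX s t Hst). reflexivity. }
  destruct (K (fun u v => x3 (X u v)) (fun s => x3 (c s))
              (fun t => r * (sinh t * x3 e1 + cosh t * x3 e2)) S3)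
    as [C1 [C2 [C3 [C4 [C5 [C6 C7]]]]]].
  { intros s t Hst. rewrite (HX s t Hst). reflexivity. }
  rewrite Derive_hyperbolic in A4, B4, C4.
  rewrite Derive2_hyperbolic in A7, B7, C7.
  repeat split; trivial.
  - exact (f_equal2 pair (f_equal2 pair A3 B3) C3).
  - exact (f_equal2 pair (f_equal2 pair A4 B4) C4).
  - exact (f_equal2 pair (f_equal2 pair A5 B5) C5).
  - exact (f_equal2 pair (f_equal2 pair A6 B6) C6).
  - exact (f_equal2 pair (f_equal2 pair A7 B7) C7).
Qed.

Lemma is_derive_lor (c : R -> L3) (m : L3) (u : R) :
  differentiable c u ->
  is_derive (fun s => lor (c s) m) u (lor (velocity c u) m).
Proof.
  assert (G : forall (f g h : R -> R) (k1 k2 k3 : R),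
    ex_derive f u -> ex_derive g u -> ex_derive h u ->
    is_derive (fun s => f s * k1 + g s * k2 - h s * k3) u
      (Derive f u * k1 + Derive g u * k2 - Derive h u * k3)).
  { intros f g h k1 k2 k3 Hf Hg Hh. auto_derive; [auto|].
    change (Derive (fun x => f x) u) with (Derive f u).
    change (Derive (fun x => g x) u) with (Derive g u).
    change (Derive (fun x => h x) u) with (Derive h u). ring. }
  intros [H1 [H2 H3]].
  exact (G (fun s => x1 (c s)) (fun s => x2 (c s)) (fun s => x3 (c s))
           (x1 m) (x2 m) (x3 m) H1 H2 H3).
Qed.

Lemma frame_map_curve (e1 e2 : L3) (c : R -> L3) (u : R) :
  differentiable c u ->
  differentiable (fun s => frame_map e1 e2 (c s)) u /\
  velocity (fun s => frame_map e1 e2 (c s)) u = frame_map e1 e2 (velocity c u).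
Proof.
  intros Hc.
  assert (H1 := is_derive_lor c (cross e1 e2) u Hc).
  assert (H2 := is_derive_lor c e1 u Hc).
  assert (H3 := is_derive_opp _ _ _ (is_derive_lor c e2 u Hc)).
  split.
  - split; [|split]; eexists; eassumption.
  - exact (f_equal2 pair (f_equal2 pair (is_derive_unique _ _ _ H1)
             (is_derive_unique _ _ _ H2)) (is_derive_unique _ _ _ H3)).
Qed.

Lemma velocity_ext_loc (c c' : R -> L3) (u : R) :
  locally u (fun s => c s = c' s) -> velocity c u = velocity c' u.
Proof.
  intros H. unfold velocity.
  rewrite (Derive_ext_loc (fun s => x1 (c s)) (fun s => x1 (c' s))),
    (Derive_ext_loc (fun s => x2 (c s)) (fun s => x2 (c' s))),
    (Derive_ext_loc (fun s => x3 (c s)) (fun s => x3 (c' s))); trivial;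
    revert H; apply filter_imp; intros s ->; reflexivity.
Qed.

Lemma differentiable_ext_loc (c c' : R -> L3) (u : R) :
  locally u (fun s => c s = c' s) -> differentiable c u -> differentiable c' u.
Proof.
  intros H [H1 [H2 H3]]. split; [|split];
    [apply (fun E => ex_derive_ext_loc _ _ _ E H1)
    |apply (fun E => ex_derive_ext_loc _ _ _ E H2)
    |apply (fun E => ex_derive_ext_loc _ _ _ E H3)];
    revert H; apply filter_imp; intros s ->; reflexivity.
Qed.

Lemma frame_map_curve2 (e1 e2 : L3) (c : R -> L3) (u : R) :
  locally u (differentiable c) -> differentiable (velocity c) u ->
  let g := fun s => frame_map e1 e2 (c s) in
  differentiable (velocity g) u /\
  velocity (velocity g) u = frame_map e1 e2 (velocity (velocity c) u).
Proof.
  intros Hc Hv g.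
  assert (E : locally u (fun s => frame_map e1 e2 (velocity c s) = velocity g s)).
  { revert Hc. apply filter_imp. intros s Hs. symmetry.
    apply (frame_map_curve e1 e2 c s Hs). }
  destruct (frame_map_curve e1 e2 (velocity c) u Hv) as [H1 H2]. split.
  - exact (differentiable_ext_loc _ _ _ E H1).
  - rewrite <- H2. symmetry. apply velocity_ext_loc, E.
Qed.

(* [V], [W] are the first two derivatives of the curve of centers, [T], [T'] those of the
   leaf; the mixed derivative of the surface vanishes. *)
Lemma leaf_curvature_numerator (r v : R) (e1 e2 V W : L3) :
  orthonormal_frame e1 e2 ->
  let T := scal3 r (add3 (scal3 (cosh v) e1) (scal3 (sinh v) e2)) in
  let T' := scal3 r (add3 (scal3 (sinh v) e1) (scal3 (cosh v) e2)) in
  let p := frame_map e1 e2 V in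
  let q := frame_map e1 e2 W in
  gram V T = r ^ 2 * (x1 p ^ 2 - (x2 p * sinh v - x3 p * cosh v) ^ 2) /\
  lor (cross V T) W * lor T T + lor (cross V T) T' * lor V V =
  r ^ 2 * ((x1 q * x2 p - x1 p * x2 q) * r * sinh v
           - (x1 q * x3 p - x1 p * x3 q) * r * cosh v
           + x1 p * (x1 p ^ 2 + x2 p ^ 2 - x3 p ^ 2)).
Proof.
  intros He T T' p q.
  assert (I := proj2 (proj2 (linear_isometry_frame_map e1 e2 He))).
  assert (ET : frame_map e1 e2 T = (0, r * cosh v, r * sinh v)).
  { rewrite <- (frame_map_combination e1 e2 (r * cosh v) (r * sinh v) He). f_equal.
    unfold T, scal3, add3; cbn -[sinh cosh]. repeat apply (f_equal2 pair); ring. }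
  assert (ET' : frame_map e1 e2 T' = (0, r * sinh v, r * cosh v)).
  { rewrite <- (frame_map_combination e1 e2 (r * sinh v) (r * cosh v) He). f_equal.
    unfold T', scal3, add3; cbn -[sinh cosh]. repeat apply (f_equal2 pair); ring. }
  assert (C : cosh v ^ 2 = 1 + sinh v ^ 2) by apply cosh_sqr.
  unfold gram. rewrite <- (lor_cross_frame_map e1 e2 V T W He).
  rewrite <- (lor_cross_frame_map e1 e2 V T T' He).
  rewrite <- (I V V), <- (I V T), <- (I T T), ET, ET'. fold p q.
  destruct p as [[p1 p2] p3], q as [[q1 q2] q3]. unfold lor, cross; cbn [x1 x2 x3 fst snd].
  generalize (sinh v) (cosh v) C; intros S K CK. split; ring [CK].
Qed.

Lemma locally_derive_zero (f f' : R -> R) (k v : R) :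
  (forall t, is_derive f t (f' t)) ->
  locally v (fun t => f t = k) -> locally v (fun t => f' t = 0).
Proof.
  intros Hf H. generalize (locally_locally v _ H). apply filter_imp.
  intros t Ht. rewrite <- (is_derive_unique _ _ _ (Hf t)).
  rewrite (Derive_ext_loc _ (fun _ => k) _ Ht). apply Derive_const.
Qed.

(** One differentiation removes [k], a second one gives the homogeneous combination again; the two
    form a linear system in [a, b] with determinant [cosh^2 - sinh^2 = 1] up to sign. *)
Lemma hyperbolic_independent (a b k v : R) :
  locally v (fun t => a * sinh t + b * cosh t + k = 0) ->
  a = 0 /\ b = 0 /\ k = 0.
Proof.
  intros H0.
  assert (H1 : locally v (fun t => a * cosh t + b * sinh t = 0)).
  { refine (locally_derive_zero _ _ 0 v _ H0). intros t. auto_derive; trivial. ring. }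
  assert (H2 : locally v (fun t => a * sinh t + b * cosh t = 0)).
  { refine (locally_derive_zero _ _ 0 v _ H1). intros t. auto_derive; trivial. ring. }
  apply locally_singleton in H0, H1, H2. assert (C := cosh_sqr v).
  assert (a = 0).
  { replace a with (a * (cosh v ^ 2 - sinh v ^ 2)) by (rewrite C; ring).
    replace (a * _) with ((a * cosh v + b * sinh v) * cosh v
                          - (a * sinh v + b * cosh v) * sinh v) by ring.
    rewrite H1, H2. ring. }
  assert (b = 0).
  { replace b with (b * (cosh v ^ 2 - sinh v ^ 2)) by (rewrite C; ring).
    replace (b * _) with ((a * sinh v + b * cosh v) * cosh v
                          - (a * cosh v + b * sinh v) * sinh v) by ring.
    rewrite H1, H2. ring. }
  repeat split; trivial. lra.
Qed.

(** A vector in the kernel of an isometry is orthogonal to everything, and the metric is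
    nondegenerate. *)
Lemma frame_map_eq_zero (e1 e2 z : L3) :
  orthonormal_frame e1 e2 -> frame_map e1 e2 z = zero3 -> z = zero3.
Proof.
  intros He Hz.
  assert (I := proj2 (proj2 (linear_isometry_frame_map e1 e2 He))).
  assert (N : forall w, lor z w = 0).
  { intros w. rewrite <- I, Hz. unfold lor; cbn. ring. }
  generalize (N (1, 0, 0)) (N (0, 1, 0)) (N (0, 0, 1)).
  destruct z as [[z1 z2] z3]. unfold lor, zero3; cbn. intros.
  repeat apply (f_equal2 pair); lra.
Qed.

(* The curvature equation is only available at nondegenerate points, but these occur on every
   leaf: otherwise [(x2 p sinh v - x3 p cosh v)^2] would be constant in [v], which forces
   [p = 0]. *)
Lemma center_curve_equations (r : R) (e1 e2 : L3) (c : R -> L3)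
    (D : R * R -> Prop) (X : R -> R -> L3) :
  0 < r -> surface D X -> orthonormal_frame e1 e2 ->
  (forall u v, D (u, v) -> X u v = spacelike_circle e1 e2 (c u) r v) ->
  ZMC D X ->
  let g := fun s => frame_map e1 e2 (c s) in
  forall u v, D (u, v) ->
    let p := velocity g u in
    let q := velocity (velocity g) u in
    differentiable g u /\ differentiable (velocity g) u /\
    x1 q * x2 p = x1 p * x2 q /\ x1 q * x3 p = x1 p * x3 q /\
    x1 p * (x1 p ^ 2 + x2 p ^ 2 - x3 p ^ 2) = 0 /\
    (x1 p <> 0 \/ x2 p * sinh v - x3 p * cosh v <> 0).
Proof.
  intros Hr HS He HX HZ g u v Hp p q.
  assert (HD := proj1 HS).
  assert (K := circle_foliation_derivatives r e1 e2 c D X HS HX).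
  assert (Lc : locally u (differentiable c)).
  { generalize (open_slice1 D u v HD Hp). apply filter_imp. intros s Hs. apply (K s v Hs). }
  destruct (frame_map_curve e1 e2 c u (locally_singleton _ _ Lc)) as [Dg Vg].
  destruct (frame_map_curve2 e1 e2 c u Lc) as [Dg2 Vg2]; [apply (K u v Hp)|].
  fold g in Vg, Vg2. fold p in Vg. fold q in Vg2. clearbody p q.
  (* If both fail, [p] is a multiple of the leaf direction [(0, cosh t, sinh t)], with factor
     [x2 p cosh t - x3 p sinh t]; this yields a vanishing combination of [du X] and [dv X] with
     coefficient [r <> 0]. *)
  assert (Imm : forall t, D (u, t) -> x1 p <> 0 \/ x2 p * sinh t - x3 p * cosh t <> 0).
  { intros t Ht. apply not_and_or. intros [P1 Pw].
    destruct HS as [_ [_ [_ [_ [_ Inj]]]]].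
    destruct (K u t Ht) as [_ [_ [Eu [Ev _]]]].
    destruct (Inj u t Ht r (- (x2 p * cosh t - x3 p * sinh t))) as [R0 _]; [|lra].
    rewrite Eu, Ev. apply (frame_map_eq_zero e1 e2 _ He).
    destruct (linear_isometry_frame_map e1 e2 He) as [Add [Scal _]].
    rewrite Add, !Scal, (frame_map_combination e1 e2 _ _ He), <- Vg.
    assert (C := cosh_sqr t).
    destruct p as [[p1 p2] p3]. cbn [x1 x2 x3 fst snd] in *.
    unfold add3, scal3, zero3; cbn [x1 x2 x3 fst snd]. rewrite P1.
    assert (Hw : p2 * sinh t = p3 * cosh t) by lra.
    repeat apply (f_equal2 pair).
    - ring.
    - transitivity (r * (p2 * (1 - cosh t ^ 2) + p3 * cosh t * sinh t)); [ring|].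
      rewrite <- Hw, C. ring.
    - transitivity (r * (p3 * (1 + sinh t ^ 2) - p2 * sinh t * cosh t)); [ring|].
      rewrite Hw, <- C. ring. }
  assert (Nondeg : exists t, D (u, t) /\ (x2 p * sinh t - x3 p * cosh t) ^ 2 <> x1 p ^ 2).
  { apply NNPP. intros Hn.
    assert (Hw : locally v (fun t => (x2 p * sinh t - x3 p * cosh t) ^ 2 = x1 p ^ 2)).
    { generalize (open_slice2 D u v HD Hp). apply filter_imp. intros t Ht.
      apply NNPP. intros Hne. apply Hn. exists t. auto. }
    assert (Hw' : locally v (fun t => 2 * ((x2 p * sinh t - x3 p * cosh t)
                     * (x2 p * cosh t - x3 p * sinh t)) = 0)).
    { refine (locally_derive_zero _ _ _ v _ Hw). intros t. auto_derive; trivial. ring. }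
    assert (Hw'' : locally v (fun t => (- x3 p) * sinh t + x2 p * cosh t + 0 = 0)).
    { generalize (filter_and _ _ (open_slice2 D u v HD Hp) (filter_and _ _ Hw Hw')).
      apply filter_imp. intros t [Ht [Wt Wt']].
      (* A zero here would make [x1 p] vanish as well, against [Imm]; hence the other factor of the
         derivative is the one that vanishes. *)
      assert (N : x2 p * sinh t - x3 p * cosh t <> 0).
      { intros N. destruct (Imm t Ht) as [P|P]; [|exact (P N)]. apply P.
        rewrite N in Wt. apply NNPP. intros P'. apply (pow_nonzero _ 2) in P'. lra. }
      apply Rmult_integral in Wt'. destruct Wt' as [Wt'|Wt']; [lra|].
      apply Rmult_integral in Wt'. destruct Wt' as [Wt'|Wt']; [contradiction|lra]. }
    apply hyperbolic_independent in Hw''. destruct Hw'' as [A3 [A2 _]].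
    assert (B3 : x3 p = 0) by lra.
    apply locally_singleton in Hw. rewrite A2, B3 in Hw.
    destruct (Imm v Hp) as [P|P]; [|rewrite A2, B3 in P; lra].
    apply (pow_nonzero _ 2) in P. lra. }
  destruct Nondeg as [t0 [Ht0 N0]].
  (* Nondegeneracy persists near [t0], so the curvature equation holds on an interval of the leaf,
     as the independence of 1, sinh and cosh requires. *)
  assert (Hloc : locally t0 (fun t =>
    ((x1 q * x2 p - x1 p * x2 q) * r) * sinh t
    + (- ((x1 q * x3 p - x1 p * x3 q) * r)) * cosh t
    + x1 p * (x1 p ^ 2 + x2 p ^ 2 - x3 p ^ 2) = 0)).
  { assert (N : locally t0 (fun t =>
              (x2 p * sinh t - x3 p * cosh t) ^ 2 - x1 p ^ 2 <> 0)).
    { apply (locally_neq_zero (fun t => (x2 p * sinh t - x3 p * cosh t) ^ 2 - x1 p ^ 2));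
        [|lra].
      apply (ex_derive_continuous
               (fun t => (x2 p * sinh t - x3 p * cosh t) ^ 2 - x1 p ^ 2)).
      auto_derive; trivial. }
    generalize (filter_and _ _ (open_slice2 D u t0 HD Ht0) N). apply filter_imp.
    intros t [Ht Nt].
    destruct (K u t Ht) as [_ [_ [Eu [Ev [Euu [Euv Evv]]]]]].
    destruct (leaf_curvature_numerator r t e1 e2 (velocity c u)
                (velocity (velocity c) u) He) as [L1 L2].
    rewrite <- Vg in L1, L2. rewrite <- Vg2 in L2. rewrite <- Eu, <- Ev in L1.
    assert (Hr2 : r ^ 2 <> 0) by (apply pow_nonzero; lra).
    assert (Hgram : gram (du X u t) (dv X u t) <> 0).
    { rewrite L1. apply Rmult_integral_contrapositive_currified; [exact Hr2|lra]. }
    generalize (ZMC_numerator D X u t HZ Ht Hgram).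
    unfold curvature_numerator. rewrite Euu, Euv, Evv, Eu, Ev. intros Z.
    replace (lor _ zero3) with 0 in Z by (unfold lor, zero3; cbn; ring).
    apply (Rmult_eq_reg_l (r ^ 2)); [|exact Hr2].
    rewrite Rmult_0_r. lra. }
  apply hyperbolic_independent in Hloc. destruct Hloc as [H1 [H2 H3]].
  split; [exact Dg|]. split; [exact Dg2|].
  split; [apply (Rmult_eq_reg_r r); lra|].
  split; [apply (Rmult_eq_reg_r r); lra|].
  split; [exact H3|exact (Imm v Hp)].
Qed.

(** * Planar surfaces are rotational *)

Lemma zero_between (f : R -> R) (a b : R) :
  (forall t, Rmin a b <= t <= Rmax a b -> continuity_pt f t) ->
  f a < 0 < f b -> exists z, Rmin a b <= z <= Rmax a b /\ f z = 0.
Proof.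
  intros Hc [Ha Hb]. destruct (Rtotal_order a b) as [H|[H|H]].
  - rewrite Rmin_left, Rmax_right in * by lra.
    destruct (IVT_interv f a b Hc H Ha Hb) as [z Hz]. exists z. exact Hz.
  - subst. lra.
  - rewrite Rmin_right, Rmax_left in * by lra.
    destruct (IVT_interv (fun t => - f t) b a) as [z [Hz Hz0]]; try lra.
    + intros t Ht. apply continuity_pt_opp, Hc, Ht.
    + exists z. split; [exact Hz|lra].
Qed.

Lemma sign_change (f : R -> R) (x m d : R) :
  is_derive f x m -> m <> 0 -> f x = 0 -> 0 < d ->
  exists a b, Rabs (a - x) < d /\ Rabs (b - x) < d /\ f a < 0 < f b.
Proof.
  assert (Pos : forall (f : R -> R) m, is_derive f x m -> 0 < m -> f x = 0 -> 0 < d ->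
    exists a b, Rabs (a - x) < d /\ Rabs (b - x) < d /\ f a < 0 < f b).
  { clear f m. intros f m Hf Hm Hx Hd. apply is_derive_Reals in Hf.
    destruct (Hf (m / 2)) as [e He]; [lra|].
    set (h := Rmin d e / 2).
    assert (Hh : 0 < h /\ h < d /\ h < e).
    { unfold h. generalize (cond_pos e). unfold Rmin. destruct Rle_dec; lra. }
    exists (x + - h), (x + h).
    replace (x + - h - x) with (- h) by ring. replace (x + h - x) with h by ring.
    rewrite Rabs_Ropp, (Rabs_pos_eq h) by lra.
    split; [lra|]. split; [lra|].
    assert (K1 := He (- h)). assert (K2 := He h).
    rewrite Rabs_Ropp, (Rabs_pos_eq h) in K1 by lra. rewrite (Rabs_pos_eq h) in K2 by lra.
    specialize (K1 ltac:(lra) ltac:(lra)). specialize (K2 ltac:(lra) ltac:(lra)).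
    rewrite Hx, Rminus_0_r in K1, K2. apply Rabs_def2 in K1, K2.
    assert (E1 : f (x + - h) = - h * (f (x + - h) / - h)) by (field; lra).
    assert (E2 : f (x + h) = h * (f (x + h) / h)) by (field; lra).
    rewrite E1, E2. nra. }
  intros Hf Hm Hx Hd. destruct (Rlt_or_le 0 m) as [P|P].
  - exact (Pos f m Hf P Hx Hd).
  - destruct (Pos (fun t => - f t) (- m)) as [a [b [Ha [Hb H]]]]; try lra.
    + apply @is_derive_opp, Hf.
    + exists b, a. split; [exact Hb|]. split; [exact Ha|]. lra.
Qed.

(** In the null coordinates [x3 + x2] and [x3 - x2] a leaf is
    [(al u + r exp v, be u + r exp (- v))], and a boost multiplies them by [exp s] and [exp (- s)].
    So this says that small boosts of a point stay on the planar surface. Eliminating [v] leaves one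
    equation in [u], with a simple zero at [s = 0], which the intermediate value theorem continues
    to small [s]. *)
Lemma null_boost_solvable (al be : R -> R) (r u0 v0 : R) (d : posreal) :
  0 < r ->
  locally u0 (fun u => ex_derive al u /\ ex_derive be u) ->
  Derive al u0 * exp (- v0) + Derive be u0 * exp v0 <> 0 ->
  locally 0 (fun s => exists u v, Rabs (u - u0) < d /\ Rabs (v - v0) < d /\
    al u + r * exp v = exp s * (al u0 + r * exp v0) /\
    be u + r * exp (- v) = exp (- s) * (be u0 + r * exp (- v0))).
Proof.
  intros Hr Hd Hne.
  set (A := al u0 + r * exp v0). set (B := be u0 + r * exp (- v0)).
  assert (Ev : exp v0 * exp (- v0) = 1) by (rewrite <- exp_plus, Rplus_opp_r; apply exp_0).
  (* Here [y] stands for the value to be taken by [r exp v]: near [r exp v0] it is positive and its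
     logarithm gives a [v] within [d] of [v0]. *)
  assert (Hy : locally (r * exp v0) (fun y => 0 < y /\ Rabs (ln (y / r) - v0) < d)).
  { assert (P : 0 < r * exp v0) by (apply Rmult_lt_0_compat; [exact Hr|apply exp_pos]).
    apply filter_and.
    - exists (mkposreal _ P). intros y Hy. change (Rabs (y - r * exp v0) < r * exp v0) in Hy.
      apply Rabs_def2 in Hy. lra.
    - assert (Hc : continuous (fun y => ln (y / r)) (r * exp v0)).
      { apply (ex_derive_continuous (fun y => ln (y / r))). auto_derive.
        apply Rdiv_lt_0_compat; assumption. }
      apply (filterlim_locally (fun y => ln (y / r))) with (eps := d) in Hc.
      revert Hc. apply filter_imp. intros y Hyb.
      replace (ln (r * exp v0 / r)) with v0 in Hyb; [exact Hyb|].
      replace (r * exp v0 / r) with (exp v0) by (field; lra). symmetry. apply ln_exp. }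
  destruct Hy as [e He].
  assert (Hal : locally u0 (fun u => Rabs (al u - al u0) < e / 2)).
  { destruct (locally_singleton _ _ Hd) as [D1 _].
    assert (Hc := ex_derive_continuous al u0 D1).
    apply (proj1 (filterlim_locally al _) Hc (pos_div_2 e)). }
  destruct (filter_and _ _ Hd Hal) as [d1 Hd1].
  (* The two residues must be [r exp v] and [r exp (- v)]; for a positive first residue this is
     possible exactly when their product is [r ^ 2]. *)
  set (G := fun s u => (exp s * A - al u) * (exp (- s) * B - be u) - r ^ 2).
  assert (HG : is_derive (G 0) u0
                 (- r * (Derive al u0 * exp (- v0) + Derive be u0 * exp v0))).
  { destruct (locally_singleton _ _ Hd) as [D1 D2]. unfold G.
    auto_derive; [auto|]. rewrite exp_0, Ropp_0, exp_0.
    change (Derive (fun x => al x) u0) with (Derive al u0).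
    change (Derive (fun x => be x) u0) with (Derive be u0).
    unfold A, B. ring. }
  destruct (sign_change (G 0) u0 _ (Rmin d d1) HG) as [a [b [Ha [Hb Hab]]]].
  { apply Rmult_integral_contrapositive_currified; [lra|exact Hne]. }
  { unfold G. rewrite Ropp_0, exp_0. unfold A, B.
    transitivity (r ^ 2 * (exp v0 * exp (- v0)) - r ^ 2); [ring|]. rewrite Ev. ring. }
  { apply Rmin_pos; apply cond_pos. }
  assert (Near : forall t, Rmin a b <= t <= Rmax a b -> Rabs (t - u0) < Rmin d d1).
  { intros t Ht. apply Rabs_def2 in Ha, Hb. apply Rabs_def1; revert Ht;
      unfold Rmin at 1, Rmax; destruct Rle_dec; lra. }
  assert (Sgn : forall t, continuous (fun s => G s t) 0).
  { intros t. apply (ex_derive_continuous (fun s => G s t)). unfold G.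
    generalize (al t) (be t). intros x y. auto_derive; trivial. }
  (* The points [a, b] are fixed, so the strict signs of [G] there survive for small [s]. *)
  assert (Ga : locally 0 (fun s => G s a < 0)).
  { apply (Sgn a (fun y => y < 0)). apply open_lt. lra. }
  assert (Gb : locally 0 (fun s => 0 < G s b)).
  { apply (Sgn b (fun y => 0 < y)). apply open_gt. lra. }
  assert (HA : locally 0 (fun s => Rabs (exp s * A - A) < e / 2)).
  { assert (Hc : continuous (fun s => exp s * A) 0).
    { apply (ex_derive_continuous (fun s => exp s * A)). auto_derive; trivial. }
    generalize (proj1 (filterlim_locally (fun s => exp s * A) _) Hc (pos_div_2 e)).
    apply filter_imp. intros s. rewrite exp_0, Rmult_1_l. trivial. }
  generalize (filter_and _ _ Ga (filter_and _ _ Gb HA)). apply filter_imp.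
  intros s [Gas [Gbs HAs]].
  destruct (zero_between (G s) a b) as [u [Hu Gu]]; [|lra|].
  { intros t Ht. apply continuity_pt_filterlim, (ex_derive_continuous (G s) t).
    destruct (Hd1 t) as [[D1 D2] _].
    { apply Rlt_le_trans with (1 := Near t Ht). apply Rmin_r. }
    unfold G. auto_derive; auto. }
  assert (Hu0 := Near u Hu).
  destruct (Hd1 u) as [_ Hau].
  { apply Rlt_le_trans with (1 := Hu0). apply Rmin_r. }
  destruct (He (exp s * A - al u)) as [Pos Hln].
  { change (Rabs (exp s * A - al u - r * exp v0) < e).
    replace (exp s * A - al u - r * exp v0)
      with ((exp s * A - A) - (al u - al u0)) by (unfold A; ring).
    apply Rabs_def2 in Hau, HAs. apply Rabs_def1; lra. }
  exists u, (ln ((exp s * A - al u) / r)).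
  split; [apply Rlt_le_trans with (1 := Hu0), Rmin_l|]. split; [exact Hln|].
  rewrite exp_Ropp, exp_ln by (apply Rdiv_lt_0_compat; assumption).
  split; [field; lra|]. unfold G in Gu.
  replace (r * / ((exp s * A - al u) / r)) with (r ^ 2 / (exp s * A - al u)) by (field; lra).
  replace (r ^ 2) with ((exp s * A - al u) * (exp (- s) * B - be u)) by lra.
  field. lra.
Qed.

Lemma frame_map_injective (e1 e2 p q : L3) :
  orthonormal_frame e1 e2 -> frame_map e1 e2 p = frame_map e1 e2 q -> p = q.
Proof.
  intros He Heq.
  destruct (linear_isometry_frame_map e1 e2 He) as [Add [Scal _]].
  assert (Z : add3 p (scal3 (-1) q) = zero3).
  { apply (frame_map_eq_zero e1 e2 _ He). rewrite Add, Scal, Heq.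
    unfold add3, scal3, zero3; cbn. repeat apply (f_equal2 pair); ring. }
  destruct p as [[p1 p2] p3], q as [[q1 q2] q3].
  unfold add3, scal3, zero3 in Z; cbn in Z. injection Z as Z1 Z2 Z3.
  repeat apply (f_equal2 pair); lra.
Qed.

Definition boost (e1 e2 : L3) (s : R) (q : L3) : L3 :=
  let y := frame_map e1 e2 q in
  add3 (scal3 (x1 y) (cross e1 e2))
    (add3 (scal3 (cosh s * x2 y + sinh s * x3 y) e1)
          (scal3 (sinh s * x2 y + cosh s * x3 y) e2)).

Lemma frame_map_boost (e1 e2 : L3) (s : R) (q : L3) :
  orthonormal_frame e1 e2 ->
  let y := frame_map e1 e2 q in
  frame_map e1 e2 (boost e1 e2 s q) =
  (x1 y, cosh s * x2 y + sinh s * x3 y, sinh s * x2 y + cosh s * x3 y).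
Proof.
  intros He y. unfold boost. fold y.
  destruct (linear_isometry_frame_map e1 e2 He) as [Add [Scal _]].
  rewrite Add, Scal, (frame_map_combination e1 e2 _ _ He).
  replace (frame_map e1 e2 (cross e1 e2)) with (1, 0, 0).
  - unfold add3, scal3; cbn [x1 x2 x3 fst snd]. repeat apply (f_equal2 pair); ring.
  - destruct He as [H1 [H2 H3]]. unfold frame_map.
    rewrite lor_cross_cross, H1, H2, H3. unfold lor, cross; cbn.
    repeat apply (f_equal2 pair); ring.
Qed.

Lemma sinh_plus (s t : R) : sinh (s + t) = sinh s * cosh t + cosh s * sinh t.
Proof. unfold sinh, cosh. rewrite Ropp_plus_distr, !exp_plus. field. Qed.

Lemma cosh_plus (s t : R) : cosh (s + t) = cosh s * cosh t + sinh s * sinh t.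
Proof. unfold sinh, cosh. rewrite Ropp_plus_distr, !exp_plus. field. Qed.

Lemma linear_isometry_boost (e1 e2 : L3) (s : R) :
  orthonormal_frame e1 e2 -> linear_isometry (boost e1 e2 s).
Proof.
  intros He.
  destruct (linear_isometry_frame_map e1 e2 He) as [Add [Scal Iso]].
  split; [|split].
  - intros p q. apply (frame_map_injective e1 e2 _ _ He).
    rewrite Add, !frame_map_boost, Add by exact He.
    unfold add3; cbn [x1 x2 x3 fst snd]. repeat apply (f_equal2 pair); ring.
  - intros k p. apply (frame_map_injective e1 e2 _ _ He).
    rewrite Scal, !frame_map_boost, Scal by exact He.
    unfold scal3; cbn [x1 x2 x3 fst snd]. repeat apply (f_equal2 pair); ring.
  - intros p q. rewrite <- Iso, !frame_map_boost, <- (Iso p q) by exact He.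
    assert (C := cosh_sqr s). unfold lor; cbn [x1 x2 x3 fst snd]. ring [C].
Qed.

Lemma rotation_group_boost (e1 e2 : L3) :
  orthonormal_frame e1 e2 ->
  rotation_group zero3 (cross e1 e2) (boost e1 e2).
Proof.
  intros He.
  destruct (linear_isometry_frame_map e1 e2 He) as [Add [Scal Iso]].
  split; [|split; [|split; [|split]]].
  - intros s. exists (boost e1 e2 s), zero3. split; [apply linear_isometry_boost, He|].
    intros p. destruct (boost e1 e2 s p) as [[? ?] ?]. unfold add3, zero3; cbn.
    repeat apply (f_equal2 pair); ring.
  - intros s t q. apply (frame_map_injective e1 e2 _ _ He).
    rewrite !frame_map_boost by exact He. cbn [x1 x2 x3 fst snd].
    rewrite sinh_plus, cosh_plus. repeat apply (f_equal2 pair); ring.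
  - intros q s.
    assert (G : forall a b k1 k2 k3 k4, continuous (fun s =>
              k1 + ((cosh s * a + sinh s * b) * k2 + (sinh s * k3 + cosh s * b) * k4)) s).
    { intros. apply (ex_derive_continuous (fun s =>
        k1 + ((cosh s * a + sinh s * b) * k2 + (sinh s * k3 + cosh s * b) * k4))).
      auto_derive; trivial. }
    split; [|split]; apply G.
  - exists 1, e1. intros Hfix. apply (f_equal (frame_map e1 e2)) in Hfix.
    rewrite frame_map_boost in Hfix by exact He.
    apply (f_equal x3) in Hfix. destruct He as [H1 [_ H3]].
    unfold frame_map in Hfix; cbn [x1 x2 x3 fst snd] in Hfix. rewrite H1, H3 in Hfix.
    generalize (sinh_lt 0 1 Rlt_0_1). rewrite sinh_0. lra.
  - intros s k. apply (frame_map_injective e1 e2 _ _ He).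
    rewrite frame_map_boost by exact He.
    assert (Z : frame_map e1 e2 (add3 zero3 (scal3 k (cross e1 e2))) =
                (k * lor (cross e1 e2) (cross e1 e2), 0, 0)).
    { unfold frame_map. rewrite !lor_add3, !lor_scal3.
      unfold lor, cross, zero3; cbn. repeat apply (f_equal2 pair); ring. }
    rewrite Z. cbn [x1 x2 x3 fst snd]. repeat apply (f_equal2 pair); ring.
Qed.

Lemma frame_map_circle (r v : R) (e1 e2 c : L3) :
  orthonormal_frame e1 e2 ->
  let g := frame_map e1 e2 c in
  frame_map e1 e2 (spacelike_circle e1 e2 c r v) =
  (x1 g, x2 g + r * sinh v, x3 g + r * cosh v).
Proof.
  intros He g. unfold spacelike_circle.
  destruct (linear_isometry_frame_map e1 e2 He) as [Add [Scal _]].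
  rewrite Add, Scal, (frame_map_combination e1 e2 _ _ He). fold g.
  unfold add3, scal3; cbn [x1 x2 x3 fst snd]. repeat apply (f_equal2 pair); ring.
Qed.

Lemma exp_cosh_sinh (v : R) : exp v = cosh v + sinh v.
Proof. unfold cosh, sinh. field. Qed.

Lemma exp_opp_cosh_sinh (v : R) : exp (- v) = cosh v - sinh v.
Proof. unfold cosh, sinh. field. Qed.

(** Locally the surface is an open piece of a plane orthogonal to [cross e1 e2], and the last
    condition on the velocity is the immersion condition inside that plane. Boosts with axis
    [cross e1 e2] preserve the plane, and small ones keep each point in the image. *)
Lemma planar_rotational (r : R) (e1 e2 : L3) (c : R -> L3)
    (D : R * R -> Prop) (X : R -> R -> L3) :
  0 < r -> open D -> orthonormal_frame e1 e2 ->
  (forall u v, D (u, v) -> X u v = spacelike_circle e1 e2 (c u) r v) ->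
  let g := fun s => frame_map e1 e2 (c s) in
  (forall u v, D (u, v) ->
     differentiable g u /\ x1 (velocity g u) = 0 /\
     x2 (velocity g u) * sinh v - x3 (velocity g u) * cosh v <> 0) ->
  rotational D X.
Proof.
  intros Hr HD He HX g Hg.
  exists zero3, (cross e1 e2), (boost e1 e2).
  split; [|split; [apply rotation_group_boost, He|]].
  { intros Z. destruct He as [H1 [H2 H3]].
    generalize (lor_cross_cross e1 e2). rewrite H1, H2, H3, Z. unfold lor; cbn. lra. }
  intros u v Hp.
  assert (L1 : locally u (fun s => x1 (g s) = x1 (g u))).
  { apply (locally_constant_of_derive_zero (fun s => x1 (g s))).
    generalize (open_slice1 D u v HD Hp). apply filter_imp. intros s Hs.
    destruct (Hg s v Hs) as [[Ds _] [Z _]]. rewrite <- Z. apply Derive_correct, Ds. }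
  destruct L1 as [d1 Hd1]. destruct (open_box D u v HD Hp) as [d2 Hd2].
  assert (P : 0 < Rmin d1 d2) by (apply Rmin_pos; apply cond_pos).
  destruct (null_boost_solvable (fun s => x3 (g s) + x2 (g s))
              (fun s => x3 (g s) - x2 (g s)) r u v (mkposreal _ P) Hr) as [eps Heps].
  - generalize (open_slice1 D u v HD Hp). apply filter_imp. intros s Hs.
    destruct (Hg s v Hs) as [[_ [D2 D3]] _].
    split; [apply @ex_derive_plus|apply @ex_derive_minus]; assumption.
  (* For the null coordinates of [g], the required sum is [2 (x3' cosh v - x2' sinh v)], so it is
     nonzero by the immersion condition. *)
  - destruct (Hg u v Hp) as [[_ [D2 D3]] [_ N]].
    rewrite Derive_plus, Derive_minus by assumption.
    rewrite exp_opp_cosh_sinh, exp_cosh_sinh. cbn [velocity x2 x3 fst snd] in N.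
    unfold velocity in N; cbn [x2 x3 fst snd] in N. lra.
  - exists eps. split; [apply cond_pos|]. intros s Hs.
    destruct (Heps s) as [u' [v' [Hu [Hv [E1 E2]]]]].
    { change (Rabs (s - 0) < eps). rewrite Rminus_0_r. exact Hs. }
    simpl in Hu, Hv.
    exists u', v'.
    assert (Hp' : D (u', v')).
    { apply Hd2; [apply Rlt_le_trans with (1 := Hu)|apply Rlt_le_trans with (1 := Hv)];
        apply Rmin_r. }
    split; [exact Hp'|].
    apply (frame_map_injective e1 e2 _ _ He).
    rewrite (HX u' v' Hp'), (HX u v Hp), frame_map_boost, !frame_map_circle by exact He.
    fold (g u') (g u). cbn [x1 x2 x3 fst snd].
    assert (F1 : x1 (g u') = x1 (g u)).
    { apply Hd1. apply Rlt_le_trans with (1 := Hu), Rmin_l. }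
    rewrite !exp_cosh_sinh in E1. rewrite !exp_opp_cosh_sinh in E2.
    repeat apply (f_equal2 pair); lra.
Qed.

Lemma rigid_motion_frame_map (e1 e2 b : L3) :
  orthonormal_frame e1 e2 -> rigid_motion (fun q => add3 (frame_map e1 e2 q) b).
Proof.
  intros He. exists (frame_map e1 e2), b.
  split; [apply linear_isometry_frame_map, He|reflexivity].
Qed.

(** * Classification *)

(* The vector [velocity g] keeps its direction: wherever [x1] (resp. another component)
   of it is nonzero, the ratios to that component are locally constant. *)
Lemma Riemann_ZMC_example_is_model (r : R) (D : R * R -> Prop) (X : R -> R -> L3) :
  0 < r -> Riemann_ZMC_example r D X -> (exists p, D p) ->
  exists (Phi : L3 -> L3) (a : R * R) (xi : R -> R),
    rigid_motion Phi /\ r ^ 4 * lor2 a a = -1 /\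
    forall u v, D (u, v) ->
      ex_derive xi u /\ Derive xi u <> 0 /\ Phi (X u v) = model a r (xi u) v.
Proof.
  intros Hr [HS [[e1 [e2 [c [He HX]]]] [HZ HR]]] [[u0 v0] Hp0].
  assert (HD := proj1 HS). assert (HC := proj1 (proj2 HS)).
  assert (K := center_curve_equations r e1 e2 c D X Hr HS He HX HZ).
  set (g := fun s => frame_map e1 e2 (c s)) in K. cbv zeta in K.
  set (g1 := fun s => x1 (g s)). set (g2 := fun s => x2 (g s)).
  set (g3 := fun s => x3 (g s)).
  set (p1 := Derive g1). set (p2 := Derive g2). set (p3 := Derive g3).
  assert (K' : forall u v, D (u, v) ->
    (ex_derive g1 u /\ ex_derive g2 u /\ ex_derive g3 u) /\
    (ex_derive p1 u /\ ex_derive p2 u /\ ex_derive p3 u) /\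
    Derive p1 u * p2 u = p1 u * Derive p2 u /\
    Derive p1 u * p3 u = p1 u * Derive p3 u /\
    p1 u * (p1 u ^ 2 + p2 u ^ 2 - p3 u ^ 2) = 0 /\
    (p1 u <> 0 \/ p2 u * sinh v - p3 u * cosh v <> 0)) by exact K.
  assert (Slice : forall (P : R -> Prop) u v, D (u, v) ->
    (forall s t, D (s, t) -> P s) -> locally u P).
  { intros P u v Hp HP. generalize (open_slice1 D u v HD Hp). apply filter_imp.
    intros s Hs. exact (HP s v Hs). }
  (* The locally constant function is the proposition [p1 = 0] itself. Near a zero of [p1], the
     immersion makes [p2] or [p3] nonzero and the ratio of [p1] to it is constantly zero; near a
     nonzero value continuity suffices. *)
  assert (Alt : forall q, D q -> (p1 (fst q) = 0) = (p1 u0 = 0)).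
  { intros q Hq.
    refine (connected_locally_constant D (fun q => p1 (fst q) = 0) HC _ (u0, v0) q Hp0 Hq).
    intros [u v] Hp. cbn [fst].
    apply (locally_fst D (fun s => (p1 s = 0) = (p1 u = 0)) u v HD Hp).
    assert (Ex1 : locally u (fun s => ex_derive p1 s)).
    { apply (Slice _ u v Hp). intros s t Hs. apply (K' s t Hs). }
    destruct (classic (p1 u = 0)) as [Z|N].
    - assert (Zero : forall p, locally u (fun s => ex_derive p s) ->
        locally u (fun s => Derive p1 s * p s = p1 s * Derive p s) -> p u <> 0 ->
        locally u (fun s => (p1 s = 0) = (p1 u = 0))).
      { intros p Exp W Np. generalize (locally_ratio_constant p1 p u Ex1 Exp W Np).
        apply filter_imp. intros s ->. rewrite Z.
        apply propositional_extensionality.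
        split; intros _; [reflexivity|]. unfold Rdiv. ring. }
      destruct (classic (p2 u = 0)) as [Z2|N2].
      + apply (Zero p3).
        * apply (Slice _ u v Hp). intros s t Hs. apply (K' s t Hs).
        * apply (Slice _ u v Hp). intros s t Hs. apply (K' s t Hs).
        * intros Z3. destruct (K' u v Hp) as [_ [_ [_ [_ [_ [A|A]]]]]]; [contradiction|].
          apply A. rewrite Z2, Z3. ring.
      + apply (Zero p2); [| |exact N2];
          apply (Slice _ u v Hp); intros s t Hs; apply (K' s t Hs).
    - generalize (locally_neq_zero p1 u
                    (ex_derive_continuous p1 u (locally_singleton _ _ Ex1)) N).
      apply filter_imp. intros s Ns.
      apply propositional_extensionality.
      split; intros; contradiction. }
  destruct (classic (p1 u0 = 0)) as [Z|N].
  { exfalso. apply HR. apply (planar_rotational r e1 e2 c D X Hr HD He HX).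
    intros u v Hp. destruct (K u v Hp) as [A [_ [_ [_ [_ B]]]]].
    assert (Zu : p1 u = 0) by (change u with (fst (u, v)); rewrite (Alt _ Hp); exact Z).
    split; [exact A|]. split; [exact Zu|]. destruct B as [B|B]; [contradiction|exact B]. }
  assert (N1 : forall u v, D (u, v) -> p1 u <> 0).
  { intros u v Hp Zu. apply N. rewrite <- (Alt _ Hp). exact Zu. }
  (* A vanishing Wronskian of [p1] and [Derive h] makes [h] an affine function of [g1]:
     connectedness is applied first to the ratio of derivatives, then to [h - b * g1]. *)
  assert (Aff : forall h : R -> R,
    (forall u v, D (u, v) -> ex_derive h u /\ ex_derive (Derive h) u /\
       Derive p1 u * Derive h u = p1 u * Derive (Derive h) u) ->
    exists b k, forall u v, D (u, v) -> Derive h u = b * p1 u /\ h u = b * g1 u + k).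
  { intros h Hh. set (b := Derive h u0 / p1 u0).
    assert (Rat : forall u v, D (u, v) -> Derive h u / p1 u = b).
    { intros u v Hp.
      refine (connected_locally_constant D (fun q => Derive h (fst q) / p1 (fst q)) HC
                _ (u0, v0) (u, v) Hp0 Hp).
      intros [s t] Hs. cbn [fst].
      apply (locally_fst D (fun y => Derive h y / p1 y = Derive h s / p1 s) s t HD Hs).
      generalize (open_slice1 D s t HD Hs).
      assert (Q : locally s (fun y => Derive h y = Derive h s / p1 s * p1 y)).
      { apply locally_ratio_constant; [| | |exact (N1 s t Hs)];
          apply (Slice _ s t Hs); intros y z Hy;
          destruct (Hh y z Hy) as [_ [A B]]; [exact A|apply (K' y z Hy)|lra]. }
      intros DD. generalize (filter_and _ _ Q DD). apply filter_imp.
      intros y [-> Dy]. field. split; [exact (N1 s t Hs)|exact (N1 y t Dy)]. }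
    assert (Rat' : forall u v, D (u, v) -> Derive h u = b * p1 u).
    { intros u v Hp. rewrite <- (Rat u v Hp). field. exact (N1 u v Hp). }
    exists b, (h u0 - b * g1 u0). intros u v Hp. split; [exact (Rat' u v Hp)|].
    enough (h u - b * g1 u = h u0 - b * g1 u0) by lra.
    refine (connected_locally_constant D (fun q => h (fst q) - b * g1 (fst q)) HC
              _ (u0, v0) (u, v) Hp0 Hp).
    intros [s t] Hs. cbn [fst].
    apply (locally_fst D (fun y => h y - b * g1 y = h s - b * g1 s) s t HD Hs).
    apply (locally_constant_of_derive_zero (fun y => h y - b * g1 y)).
    apply (Slice _ s t Hs). intros y z Hy.
    destruct (Hh y z Hy) as [A _]. destruct (K' y z Hy) as [[B _] _].
    auto_derive; [auto|].
    change (Derive (fun x => h x) y) with (Derive h y).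
    change (Derive (fun x => g1 x) y) with (p1 y). rewrite (Rat' y z Hy). ring. }
  destruct (Aff g2) as [b2 [k2 H2]].
  { intros u v Hp. destruct (K' u v Hp) as [[_ [A _]] [[_ [B _]] [C _]]]. auto. }
  destruct (Aff g3) as [b3 [k3 H3]].
  { intros u v Hp. destruct (K' u v Hp) as [[_ [_ A]] [[_ [_ B]] [_ [C _]]]]. auto. }
  (* With [p1 <> 0] the cubic equation says that the constant direction [(1, b2, b3)] of the centers
     is lightlike. *)
  assert (Hb : b2 ^ 2 - b3 ^ 2 = -1).
  { destruct (K' u0 v0 Hp0) as [_ [_ [_ [_ [Q _]]]]].
    apply Rmult_integral in Q. destruct Q as [Q|Q]; [contradiction|].
    assert (E2 := proj1 (H2 u0 v0 Hp0)). assert (E3 := proj1 (H3 u0 v0 Hp0)).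
    fold p2 in E2. fold p3 in E3. rewrite E2, E3 in Q.
    apply (Rmult_eq_reg_l (p1 u0 ^ 2)); [lra|]. apply pow_nonzero, N. }
  (* The translation removes the constants [k2, k3], the vector [a] is chosen so that
     [r ^ 2 a = (b2, b3)], and [g1] becomes the parameter [x]. *)
  exists (fun q => add3 (frame_map e1 e2 q) (0, - k2, - k3)),
    (b2 / r ^ 2, b3 / r ^ 2), g1.
  split; [apply rigid_motion_frame_map, He|]. split.
  { transitivity (b2 ^ 2 - b3 ^ 2); [|exact Hb].
    unfold lor2, lor, emb; cbn [x1 x2 x3 fst snd]. field. lra. }
  intros u v Hp. destruct (K' u v Hp) as [[A _] _].
  split; [exact A|]. split; [exact (N1 u v Hp)|].
  rewrite (HX u v Hp), frame_map_circle by exact He. fold (g u).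
  assert (E2 := proj2 (H2 u v Hp)). assert (E3 := proj2 (H3 u v Hp)).
  unfold g2, g3 in E2, E3. rewrite E2, E3. fold (g1 u).
  unfold model, add3, scal3, emb; cbn [x1 x2 x3 fst snd].
  repeat apply (f_equal2 pair); field; lra.
Qed.

(** * The model *)

(** This family contains the coordinate functions of the model and is closed under both partial
    derivatives, so its smoothness reduces to continuity. *)
Definition hyperbolic_plus_linear (k0 k1 k2 k3 : R) : R -> R -> R :=
  fun x v => k0 * x + k1 * sinh v + k2 * cosh v + k3.

Lemma partial1_hyperbolic (k0 k1 k2 k3 : R) :
  partial1 (hyperbolic_plus_linear k0 k1 k2 k3) = hyperbolic_plus_linear 0 0 0 k0.
Proof.
  apply functional_extensionality; intros x. apply functional_extensionality; intros v.
  apply is_derive_unique. unfold hyperbolic_plus_linear. auto_derive; trivial. ring.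
Qed.

Lemma partial2_hyperbolic (k0 k1 k2 k3 : R) :
  partial2 (hyperbolic_plus_linear k0 k1 k2 k3) = hyperbolic_plus_linear 0 k2 k1 0.
Proof.
  apply functional_extensionality; intros x. apply functional_extensionality; intros v.
  apply is_derive_unique. unfold hyperbolic_plus_linear. auto_derive; trivial. ring.
Qed.

Lemma C2_on_hyperbolic (D : R * R -> Prop) (k0 k1 k2 k3 : R) :
  C2_on D (hyperbolic_plus_linear k0 k1 k2 k3).
Proof.
  assert (Cont : forall k0 k1 k2 k3 u v,
            continuity_2d_pt (hyperbolic_plus_linear k0 k1 k2 k3) u v).
  { clear. intros k0 k1 k2 k3 u v. unfold hyperbolic_plus_linear.
    apply continuity_2d_pt_plus; [|apply continuity_2d_pt_const].
    apply continuity_2d_pt_plus; [apply continuity_2d_pt_plus|].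
    - apply (continuity_1d_2d_pt_comp (fun x => k0 * x) (fun x _ => x)).
      + apply continuity_pt_filterlim, (ex_derive_continuous (fun x => k0 * x)).
        auto_derive; trivial.
      + apply continuity_2d_pt_id1.
    - apply (continuity_1d_2d_pt_comp (fun x => k1 * sinh x) (fun _ x => x)).
      + apply continuity_pt_filterlim, (ex_derive_continuous (fun x => k1 * sinh x)).
        auto_derive; trivial.
      + apply continuity_2d_pt_id2.
    - apply (continuity_1d_2d_pt_comp (fun x => k2 * cosh x) (fun _ x => x)).
      + apply continuity_pt_filterlim, (ex_derive_continuous (fun x => k2 * cosh x)).
        auto_derive; trivial.
      + apply continuity_2d_pt_id2. }
  assert (C1 : forall k0 k1 k2 k3, C1_on D (hyperbolic_plus_linear k0 k1 k2 k3)).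
  { clear -Cont. intros k0 k1 k2 k3 u v _.
    rewrite partial1_hyperbolic, partial2_hyperbolic.
    split; [|split; [|split; apply Cont]]; unfold hyperbolic_plus_linear;
      auto_derive; trivial. }
  split; [apply C1|]. rewrite partial1_hyperbolic, partial2_hyperbolic.
  split; apply C1.
Qed.

(** Direction of the straight lines [v = const] of the model. *)
Definition ruling (a : R * R) (r : R) : L3 := (1, r ^ 2 * fst a, r ^ 2 * snd a).

Lemma model_x1 (a : R * R) (r : R) :
  (fun x v => x1 (model a r x v)) = hyperbolic_plus_linear 1 0 0 0.
Proof.
  apply functional_extensionality; intros x. apply functional_extensionality; intros v.
  unfold hyperbolic_plus_linear, model; cbn. ring.
Qed.

Lemma model_x2 (a : R * R) (r : R) :
  (fun x v => x2 (model a r x v)) = hyperbolic_plus_linear (r ^ 2 * fst a) r 0 0.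
Proof.
  apply functional_extensionality; intros x. apply functional_extensionality; intros v.
  unfold hyperbolic_plus_linear, model; cbn -[sinh cosh]. ring.
Qed.

Lemma model_x3 (a : R * R) (r : R) :
  (fun x v => x3 (model a r x v)) = hyperbolic_plus_linear (r ^ 2 * snd a) 0 r 0.
Proof.
  apply functional_extensionality; intros x. apply functional_extensionality; intros v.
  unfold hyperbolic_plus_linear, model; cbn -[sinh cosh]. ring.
Qed.

Lemma du_model (a : R * R) (r : R) : du (model a r) = fun _ _ => ruling a r.
Proof.
  apply functional_extensionality; intros x. apply functional_extensionality; intros v.
  unfold du. rewrite model_x1, model_x2, model_x3, !partial1_hyperbolic.
  unfold hyperbolic_plus_linear, ruling. repeat apply (f_equal2 pair); ring.
Qed.

Lemma dv_model (a : R * R) (r : R) :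
  dv (model a r) = fun _ v => (0, r * cosh v, r * sinh v).
Proof.
  apply functional_extensionality; intros x. apply functional_extensionality; intros v.
  unfold dv. rewrite model_x1, model_x2, model_x3, !partial2_hyperbolic.
  unfold hyperbolic_plus_linear. repeat apply (f_equal2 pair); ring.
Qed.

Lemma cosh_pos (v : R) : 0 < cosh v.
Proof. unfold cosh. generalize (exp_pos v) (exp_pos (- v)). lra. Qed.

Lemma surface_model (a : R * R) (r : R) :
  0 < r -> surface whole_plane (model a r).
Proof.
  intros Hr. split; [apply open_true|]. split; [apply connected_whole_plane|].
  split; [|split; [|split]].
  - rewrite model_x1. apply C2_on_hyperbolic.
  - rewrite model_x2. apply C2_on_hyperbolic.
  - rewrite model_x3. apply C2_on_hyperbolic.
  - intros x v _ k l H. rewrite du_model, dv_model in H.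
    unfold ruling, add3, scal3, zero3 in H; cbn [x1 x2 x3 fst snd] in H.
    injection H as H1 H2 _.
    assert (K : k = 0) by lra. split; [exact K|]. rewrite K in H2.
    assert (P : r * cosh v <> 0).
    { apply Rgt_not_eq, Rmult_lt_0_compat; [exact Hr|apply cosh_pos]. }
    apply (Rmult_eq_reg_r (r * cosh v)); [lra|exact P].
Qed.

Lemma model_circle (a : R * R) (r x v : R) :
  model a r x v =
  spacelike_circle (0, 1, 0) (0, 0, 1) (scal3 x (ruling a r)) r v.
Proof.
  unfold model, spacelike_circle, ruling, add3, scal3, emb; cbn -[sinh cosh].
  repeat apply (f_equal2 pair); ring.
Qed.

Lemma standard_frame : orthonormal_frame (0, 1, 0) (0, 0, 1).
Proof. unfold orthonormal_frame, lor; cbn. repeat split; ring. Qed.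

Lemma lor_ruling (a : R * R) (r : R) :
  lor (ruling a r) (ruling a r) = 1 + r ^ 4 * lor2 a a.
Proof. unfold lor2, lor, ruling, emb; cbn. ring. Qed.

(** The rulings are straight with constant direction, so [du du] and [dv du] vanish, and they are
    lightlike, so [E = 0]; every term of the numerator is zero, at degenerate points too. *)
Lemma ZMC_model (a : R * R) (r : R) :
  r ^ 4 * lor2 a a = -1 -> ZMC whole_plane (model a r).
Proof.
  intros Ha x v _ _. destruct (mean_curvature_eq (model a r) x v) as [k [_ ->]].
  unfold curvature_numerator.
  replace (du (du (model a r)) x v) with zero3.
  replace (dv (du (model a r)) x v) with zero3.
  - rewrite du_model, lor_ruling, Ha. unfold lor, zero3; cbn. ring.
  - rewrite du_model. unfold dv, partial2. rewrite !Derive_const. reflexivity.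
  - rewrite du_model. unfold du, partial1. rewrite !Derive_const. reflexivity.
Qed.

(** The velocity of the centers is [ruling a r], with first component 1, so the cubic equation for
    the centers says that the ruling is lightlike. *)
Lemma model_ZMC_constraint (a : R * R) (r : R) :
  0 < r -> ZMC whole_plane (model a r) -> r ^ 4 * lor2 a a = -1.
Proof.
  intros Hr HZ.
  assert (K := center_curve_equations r _ _ (fun s => scal3 s (ruling a r)) whole_plane
      (model a r) Hr (surface_model a r Hr) standard_frame
      (fun x v _ => model_circle a r x v) HZ 0 0 I).
  cbv zeta in K. destruct K as [_ [_ [_ [_ [K _]]]]].
  replace (velocity _ 0) with (ruling a r) in K.
  - unfold ruling in K; cbn [x1 x2 x3 fst snd] in K.
    unfold lor2, lor, emb; cbn [x1 x2 x3 fst snd]. lra.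
  - unfold velocity, ruling.
    symmetry. repeat apply (f_equal2 pair); apply is_derive_unique;
      unfold frame_map, lor, cross, scal3; cbn [x1 x2 x3 fst snd]; auto_derive; trivial; ring.
Qed.

(** * The model is not rotational *)

(* The functionals [phip] and [phim] vanish on the rulings, and the image of [model a r] is the
   sheet [phip > 0] of [phip * phim = r ^ 2]. *)
Definition phip (a : R * R) (r : R) (q : L3) : R :=
  x3 q + x2 q - r ^ 2 * (snd a + fst a) * x1 q.
Definition phim (a : R * R) (r : R) (q : L3) : R :=
  x3 q - x2 q - r ^ 2 * (snd a - fst a) * x1 q.

Lemma phip_model (a : R * R) (r x v : R) : phip a r (model a r x v) = r * exp v.
Proof.
  rewrite exp_cosh_sinh. unfold phip, model, add3, scal3, emb; cbn [x1 x2 x3 fst snd]. ring.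
Qed.

Lemma phim_model (a : R * R) (r x v : R) : phim a r (model a r x v) = r * exp (- v).
Proof.
  rewrite exp_opp_cosh_sinh.
  unfold phim, model, add3, scal3, emb; cbn [x1 x2 x3 fst snd]. ring.
Qed.

Lemma phip_add3 (a : R * R) (r : R) (p q : L3) :
  phip a r (add3 p q) = phip a r p + phip a r q.
Proof. unfold phip, add3; cbn [x1 x2 x3 fst snd]. ring. Qed.

Lemma phim_add3 (a : R * R) (r : R) (p q : L3) :
  phim a r (add3 p q) = phim a r p + phim a r q.
Proof. unfold phim, add3; cbn [x1 x2 x3 fst snd]. ring. Qed.

Lemma phip_scal3 (a : R * R) (r k : R) (p : L3) :
  phip a r (scal3 k p) = k * phip a r p.
Proof. unfold phip, scal3; cbn [x1 x2 x3 fst snd]. ring. Qed.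

Lemma phim_scal3 (a : R * R) (r k : R) (p : L3) :
  phim a r (scal3 k p) = k * phim a r p.
Proof. unfold phim, scal3; cbn [x1 x2 x3 fst snd]. ring. Qed.

Lemma phi_kernel (a : R * R) (r : R) (q : L3) :
  phip a r q = 0 -> phim a r q = 0 -> q = scal3 (x1 q) (ruling a r).
Proof.
  destruct q as [[q1 q2] q3]. unfold phip, phim, ruling, scal3; cbn [x1 x2 x3 fst snd].
  intros. repeat apply (f_equal2 pair); lra.
Qed.

(** With [num], null vectors dual to the functionals up to a factor 2: [phip] is 2 on [nup] and 0 on
    [num], and [phim] the reverse. *)
Definition nup : L3 := (0, 1, 1).
Definition num : L3 := (0, -1, 1).

Lemma ruling_basis (a : R * R) (r : R) (q : L3) :
  q = add3 (scal3 (x1 q) (ruling a r))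
        (add3 (scal3 (phip a r q / 2) nup) (scal3 (phim a r q / 2) num)).
Proof.
  destruct q as [[q1 q2] q3].
  unfold phip, phim, ruling, nup, num, add3, scal3; cbn [x1 x2 x3 fst snd].
  repeat apply (f_equal2 pair); field.
Qed.

Lemma model_basis (a : R * R) (r x v : R) :
  model a r x v =
  add3 (scal3 x (ruling a r))
    (add3 (scal3 (exp v) (scal3 (r / 2) nup)) (scal3 (/ exp v) (scal3 (r / 2) num))).
Proof.
  rewrite (ruling_basis a r (model a r x v)), phip_model, phim_model, exp_Ropp.
  unfold model, nup, num, ruling, add3, scal3, emb; cbn [x1 x2 x3 fst snd].
  repeat apply (f_equal2 pair); field; apply Rgt_not_eq, exp_pos.
Qed.

(** A lightlike ruling is orthogonal to itself, so the product with it vanishes on the common kernel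
    of [phip] and [phim] and is a combination of them. *)
Lemma lor_ruling_phi (a : R * R) (r : R) (q : L3) :
  r ^ 4 * lor2 a a = -1 ->
  lor q (ruling a r) =
  - (r ^ 2 * (snd a - fst a) * phip a r q + r ^ 2 * (snd a + fst a) * phim a r q) / 2.
Proof.
  intros Ha. unfold lor2, lor, emb in Ha; cbn [x1 x2 x3 fst snd] in Ha.
  unfold lor, ruling, phip, phim; cbn [x1 x2 x3 fst snd].
  assert (E : r ^ 4 * (fst a * fst a) = r ^ 4 * (snd a * snd a) - 1) by lra.
  transitivity (x1 q * (r ^ 4 * (snd a * snd a) - r ^ 4 * (fst a * fst a))
                + r ^ 2 * fst a * x2 q - r ^ 2 * snd a * x3 q); [|field].
  rewrite E. ring.
Qed.

(* [S] moves [q] by some [k L] with [L = ruling a r] lightlike; preserving the distance to the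
   fixed point [p] means [k <q - p, L> = 0]. *)
Lemma rigid_motion_phi_id (a : R * R) (r : R) (S : L3 -> L3) (p : L3) :
  r ^ 4 * lor2 a a = -1 -> rigid_motion S -> S p = p ->
  (forall q, phip a r (S q) = phip a r q) ->
  (forall q, phim a r (S q) = phim a r q) ->
  forall q, S q = q.
Proof.
  intros Ha [A [b [[Add [Scal Iso]] HS]]] Hp Hphi Hphm.
  set (sub := fun x y => add3 x (scal3 (-1) y)).
  assert (AddSub : forall x y, y = add3 x (sub y x)).
  { intros [[? ?] ?] [[? ?] ?]. unfold sub, add3, scal3; cbn.
    repeat apply (f_equal2 pair); ring. }
  assert (SubS : forall x y, sub (S x) (S y) = A (sub x y)).
  { intros x y. unfold sub. rewrite Add, Scal, !HS.
    destruct (A x) as [[? ?] ?], (A y) as [[? ?] ?]. unfold add3, scal3; cbn.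
    repeat apply (f_equal2 pair); ring. }
  assert (Gen : forall x, lor (sub x p) (ruling a r) <> 0 -> S x = x).
  { intros x Hx.
    assert (Hk := phi_kernel a r (sub (S x) x)).
    set (k := x1 (sub (S x) x)) in Hk.
    assert (E : S x = add3 x (scal3 k (ruling a r))).
    { rewrite <- Hk; [apply AddSub| |]; unfold sub.
      - rewrite phip_add3, phip_scal3, Hphi. ring.
      - rewrite phim_add3, phim_scal3, Hphm. ring. }
    assert (L0 : lor (ruling a r) (ruling a r) = 0) by (rewrite lor_ruling, Ha; ring).
    assert (I := Iso (sub x p) (sub x p)). rewrite <- SubS, Hp, E in I.
    assert (J : lor (sub (add3 x (scal3 k (ruling a r))) p)
                  (sub (add3 x (scal3 k (ruling a r))) p) =
                lor (sub x p) (sub x p) + 2 * k * lor (sub x p) (ruling a r)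
                + k ^ 2 * lor (ruling a r) (ruling a r)).
    { unfold sub, lor, add3, scal3; cbn [x1 x2 x3 fst snd]. ring. }
    rewrite J, L0 in I.
    assert (Hk0 : k = 0).
    { apply (Rmult_eq_reg_r (lor (sub x p) (ruling a r))); [lra|exact Hx]. }
    rewrite E, Hk0. destruct x as [[? ?] ?]. unfold add3, scal3; cbn.
    repeat apply (f_equal2 pair); ring. }
  intros q. destruct (Req_dec (lor (sub q p) (ruling a r)) 0) as [Z|N]; [|exact (Gen q N)].
  (* Shifting by [z] changes the product with the ruling by 1, so [Gen] applies to [q + z] and
     [p + z]; as [S] is affine and fixes [p], it then fixes [q]. *)
  set (z := (1, 0, 0) : L3).
  assert (Hz : lor z (ruling a r) = 1) by (unfold lor, z, ruling; cbn; ring).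
  assert (S1 : S (add3 q z) = add3 q z).
  { apply Gen. unfold sub in *. rewrite !lor_add3 in *. rewrite Hz. lra. }
  assert (S2 : S (add3 p z) = add3 p z).
  { apply Gen. unfold sub. rewrite !lor_add3, !lor_scal3, Hz. lra. }
  rewrite HS in *. rewrite Add in S1, S2.
  destruct (A p) as [[? ?] ?], (A q) as [[? ?] ?], (A z) as [[? ?] ?],
    b as [[? ?] ?], p as [[? ?] ?], q as [[? ?] ?].
  unfold z, add3 in *; cbn [x1 x2 x3 fst snd] in *.
  injection S1 as ? ? ?. injection S2 as ? ? ?. injection Hp as ? ? ?.
  repeat apply (f_equal2 pair); lra.
Qed.

(** Values of [(x, exp v)]: the product of the two functionals has degree at most 2 in the first and
    exponents from -2 to 2 in the second, whence three and five values. *)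
Definition sample : list (R * R) :=
  list_prod [0; 1; -1] [1; 2; / 2; 4; / 4].

(* Comparing coefficients of the Laurent polynomial in [(t, y)]; the points of [sample]
   suffice for its degrees. *)
Lemma hyperbola_coefficients (r a0 a1 a2 a3 b0 b1 b2 b3 : R) :
  0 < r ->
  (forall t y, In (t, y) sample ->
     (a0 + a1 * t + a2 * y + a3 * / y) * (b0 + b1 * t + b2 * y + b3 * / y) = r ^ 2) ->
  a1 = 0 /\ b1 = 0 /\
  ((a2 * b3 = r ^ 2 /\ a3 = 0 /\ b2 = 0 /\ a0 = 0 /\ b0 = 0) \/
   (a3 * b2 = r ^ 2 /\ a2 = 0 /\ b3 = 0 /\ a0 = 0 /\ b0 = 0) \/
   (a2 = 0 /\ a3 = 0 /\ b2 = 0 /\ b3 = 0)).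
Proof.
  intros Hr H.
  assert (Hr2 : 0 < r ^ 2) by (apply pow_lt, Hr).
  unfold sample in H; cbn [list_prod map app] in H.
  assert (H01 := H 0 1 ltac:(simpl; tauto)).
  assert (H02 := H 0 2 ltac:(simpl; tauto)).
  assert (H03 := H 0 (/2) ltac:(simpl; tauto)).
  assert (H04 := H 0 4 ltac:(simpl; tauto)).
  assert (H05 := H 0 (/4) ltac:(simpl; tauto)).
  assert (H11 := H 1 1 ltac:(simpl; tauto)).
  assert (H12 := H 1 2 ltac:(simpl; tauto)).
  assert (H13 := H 1 (/2) ltac:(simpl; tauto)).
  assert (H21 := H (-1) 1 ltac:(simpl; tauto)).
  assert (H22 := H (-1) 2 ltac:(simpl; tauto)).
  assert (H23 := H (-1) (/2) ltac:(simpl; tauto)).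
  clear H. set (R2 := r ^ 2) in *. clearbody R2.
  rewrite Rinv_inv in *. rewrite Rinv_1 in *.
  assert (E11 : a1 * b1 = 0) by lra.
  assert (E10 : a1 * b0 + a0 * b1 = 0) by lra.
  assert (E12 : a1 * b2 + a2 * b1 = 0) by lra.
  assert (E13 : a1 * b3 + a3 * b1 = 0) by lra.
  assert (E22 : a2 * b2 = 0) by lra.
  assert (E33 : a3 * b3 = 0) by lra.
  assert (E02 : a0 * b2 + a2 * b0 = 0) by lra.
  assert (E03 : a0 * b3 + a3 * b0 = 0) by lra.
  assert (E00 : a0 * b0 + a2 * b3 + a3 * b2 = R2) by lra.
  clear H01 H02 H03 H04 H05 H11 H12 H13 H21 H22 H23.
  assert (Cancel : forall x y, x <> 0 -> x * y = 0 -> y = 0).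
  { intros x y Hx Hxy. apply Rmult_integral in Hxy. tauto. }
  (* A nonzero [a1] forces all of [b0, b1, b2, b3] to vanish, and then the product cannot be
     [r ^ 2]; the same holds with the roles exchanged. *)
  destruct (Req_dec a1 0) as [A1|A1].
  2:{ assert (b1 = 0) by (apply (Cancel a1); lra). subst b1.
      assert (b0 = 0) by (apply (Cancel a1); lra).
      assert (b2 = 0) by (apply (Cancel a1); lra).
      assert (b3 = 0) by (apply (Cancel a1); lra). subst. lra. }
  destruct (Req_dec b1 0) as [B1|B1].
  2:{ subst a1.
      assert (a0 = 0) by (apply (Cancel b1); lra).
      assert (a2 = 0) by (apply (Cancel b1); lra).
      assert (a3 = 0) by (apply (Cancel b1); lra). subst. lra. }
  split; [exact A1|]. split; [exact B1|].
  destruct (Req_dec a2 0) as [A2|A2]; [destruct (Req_dec a3 0) as [A3|A3]|].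
  - subst. right; right.
    assert (N : a0 <> 0) by (intros ->; lra).
    repeat split; apply (Cancel a0); lra.
  - subst. right; left.
    assert (b3 = 0) by (apply (Cancel a3); lra). subst.
    assert (b0 = 0) by (apply (Cancel a3); lra). subst.
    assert (b2 <> 0) by (intros ->; lra).
    assert (a0 = 0) by (apply (Cancel b2); lra). lra.
  - left. assert (b2 = 0) by (apply (Cancel a2); lra). subst.
    assert (b0 = 0) by (apply (Cancel a2); lra). subst.
    assert (b3 <> 0) by (intros ->; lra).
    assert (a0 = 0) by (apply (Cancel b3); lra).
    assert (a3 = 0) by (apply (Cancel b3); lra). lra.
Qed.

(* A motion preserving the cylinder either preserves both functionals up to a common sign or
   exchanges them up to inverse factors; in both cases its square preserves them. *)
Lemma rigid_motion_phi_square (a : R * R) (r : R) (T : L3 -> L3) :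
  0 < r -> r ^ 4 * lor2 a a = -1 -> rigid_motion T ->
  (forall t y, In (t, y) sample -> exists x v, model a r x v = T (model a r t (ln y))) ->
  forall q, phip a r (T (T q)) = phip a r q /\ phim a r (T (T q)) = phim a r q.
Proof.
  intros Hr Ha [A [b [[Add [Scal Iso]] HT]]] HM.
  assert (Pos : forall t y, In (t, y) sample -> 0 < y).
  { intros t y H. unfold sample in H; simpl in H.
    repeat (destruct H as [H|H]; [injection H as <- <-; lra|]). destruct H. }
  assert (Exp : forall f : L3 -> R,
    (forall p q, f (add3 p q) = f p + f q) -> (forall k p, f (scal3 k p) = k * f p) ->
    forall t y, 0 < y -> f (T (model a r t (ln y))) =
      f b + f (A (ruling a r)) * t + r / 2 * f (A nup) * y + r / 2 * f (A num) * / y).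
  { intros f fA fS t y Hy. rewrite HT, model_basis, exp_ln by exact Hy.
    rewrite !Add, !Scal, !fA, !fS. ring. }
  assert (Lin : forall f : L3 -> R,
    (forall p q, f (add3 p q) = f p + f q) -> (forall k p, f (scal3 k p) = k * f p) ->
    forall q, f (A q) = x1 q * f (A (ruling a r)) + phip a r q / 2 * f (A nup)
                        + phim a r q / 2 * f (A num)).
  { intros f fA fS q. rewrite (ruling_basis a r q) at 1.
    rewrite !Add, !Scal, !fA, !fS. ring. }
  assert (LinP := Lin (phip a r) (phip_add3 a r) (phip_scal3 a r)).
  assert (LinM := Lin (phim a r) (phim_add3 a r) (phim_scal3 a r)).
  (* Along the image under [T], both functionals are Laurent polynomials in [x] and [exp v], and
     their product is [r ^ 2] because the sample points land on the sheet. *)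
  destruct (hyperbola_coefficients r (phip a r b) (phip a r (A (ruling a r)))
      (r / 2 * phip a r (A nup)) (r / 2 * phip a r (A num))
      (phim a r b) (phim a r (A (ruling a r)))
      (r / 2 * phim a r (A nup)) (r / 2 * phim a r (A num)) Hr) as [P1 [M1 Cases]].
  { intros t y Hin. assert (Hy := Pos t y Hin).
    rewrite <- (Exp _ (phip_add3 a r) (phip_scal3 a r) t y Hy).
    rewrite <- (Exp _ (phim_add3 a r) (phim_scal3 a r) t y Hy).
    destruct (HM t y Hin) as [x [v <-]]. rewrite phip_model, phim_model.
    transitivity (r ^ 2 * (exp v * exp (- v))); [ring|].
    rewrite <- exp_plus, Rplus_opp_r, exp_0. ring. }
  set (lam := phip a r (A nup) / 2). set (lam' := phip a r (A num) / 2).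
  set (mu := phim a r (A num) / 2). set (mu' := phim a r (A nup) / 2).
  assert (TP : forall q, phip a r (A q) = lam * phip a r q + lam' * phim a r q).
  { intros q. rewrite LinP, P1. unfold lam, lam'. field. }
  assert (TM : forall q, phim a r (A q) = mu' * phip a r q + mu * phim a r q).
  { intros q. rewrite LinM, M1. unfold mu, mu'. field. }
  assert (Hr2 : r ^ 2 <> 0) by (apply pow_nonzero; lra).
  assert (Half : forall x, r / 2 * x = 0 -> x / 2 = 0).
  { intros x Hx. apply (Rmult_eq_reg_l r); lra. }
  destruct Cases as [C|[C|C]].
  - destruct C as [LM [L' [M' [B0 B1]]]].
    apply Half in L', M'. fold lam' in L'. fold mu' in M'.
    assert (LM' : lam * mu = 1).
    { apply (Rmult_eq_reg_l (r ^ 2)); [|exact Hr2]. rewrite Rmult_1_r.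
      etransitivity; [|exact LM]. unfold lam, mu. field. }
    assert (EL : A (ruling a r) = scal3 (x1 (A (ruling a r))) (ruling a r))
      by (apply phi_kernel; assumption).
    set (k := x1 (A (ruling a r))) in EL.
    (* [A] scales the ruling by [k]. Testing this identity on [nup] and [num] gives
       [k lam = k mu = 1], so [lam = mu], and with [lam mu = 1] both squares are 1. *)
    assert (IsoL : forall q, k * lor (A q) (ruling a r) = lor q (ruling a r)).
    { intros q. rewrite <- (Iso q (ruling a r)), EL. unfold lor, scal3; cbn. ring. }
    assert (Sq : lam * lam = 1 /\ mu * mu = 1).
    { generalize (IsoL nup) (IsoL num). rewrite !lor_ruling_phi, !TP, !TM, L', M' by exact Ha.
      unfold lor2, lor, emb in Ha; cbn [x1 x2 x3 fst snd] in Ha.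
      unfold phip, phim, nup, num; cbn [x1 x2 x3 fst snd]. intros I1 I2.
      set (m := r ^ 2 * (snd a + fst a)) in *. set (n := r ^ 2 * (snd a - fst a)) in *.
      assert (MN : m * n = 1) by (unfold m, n; lra).
      assert (N0 : n <> 0) by (intros Z; rewrite Z in MN; lra).
      assert (M0 : m <> 0) by (intros Z; rewrite Z in MN; lra).
      assert (KL : k * lam = 1) by (apply (Rmult_eq_reg_l n); [lra|exact N0]).
      assert (KM : k * mu = 1) by (apply (Rmult_eq_reg_l m); [lra|exact M0]).
      assert (K0 : k <> 0) by (intros Z; rewrite Z in KL; lra).
      assert (Eq : lam = mu) by (apply (Rmult_eq_reg_l k); [lra|exact K0]).
      rewrite Eq in LM' |- *. auto. }
    destruct Sq as [SL SM]. intros q.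
    rewrite !HT, !phip_add3, !phim_add3, !TP, !TM, !phip_add3, !phim_add3, !TP, !TM.
    rewrite B0, B1, L', M'. split.
    + transitivity (lam * lam * phip a r q); [ring|]. rewrite SL. ring.
    + transitivity (mu * mu * phim a r q); [ring|]. rewrite SM. ring.
  - destruct C as [LM [L' [M' [B0 B1]]]].
    apply Half in L', M'. fold lam in L'. fold mu in M'.
    assert (LM' : lam' * mu' = 1).
    { apply (Rmult_eq_reg_l (r ^ 2)); [|exact Hr2]. rewrite Rmult_1_r.
      etransitivity; [|exact LM]. unfold lam', mu'. field. }
    (* The functionals are exchanged here, and the square multiplies each of them by
       [lam' * mu' = 1]. *)
    intros q.
    rewrite !HT, !phip_add3, !phim_add3, !TP, !TM, !phip_add3, !phim_add3, !TP, !TM.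
    rewrite B0, B1, L', M'. split.
    + transitivity (lam' * mu' * phip a r q); [ring|]. rewrite LM'. ring.
    + transitivity (lam' * mu' * phim a r q); [ring|]. rewrite LM'. ring.
  (* Here [A] would map all of space into the lightlike ruling direction, although the image of
     [(0, 0, 1)] has square -1. *)
  - exfalso. destruct C as [L [L' [M' M]]].
    apply Half in L, L', M', M. fold lam in L. fold lam' in L'. fold mu' in M'. fold mu in M.
    assert (E : A (0, 0, 1) = scal3 (x1 (A (0, 0, 1))) (ruling a r)).
    { apply phi_kernel; [rewrite TP, L, L'|rewrite TM, M, M']; ring. }
    generalize (Iso (0, 0, 1) (0, 0, 1)). rewrite E.
    match goal with |- lor (scal3 ?k ?l) _ = _ -> _ =>
      replace (lor (scal3 k l) (scal3 k l)) with (k ^ 2 * lor l l)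
        by (unfold lor, scal3; cbn; ring) end.
    rewrite lor_ruling, Ha. unfold lor; cbn. lra.
Qed.

(** The bound on the parameter in [rotational] depends on the point; finitely many points share
    one. *)
Lemma locally_all_in {T : Type} (P : R -> T -> Prop) (l : list T) (s0 : R) :
  (forall p, In p l -> locally s0 (fun s => P s p)) ->
  locally s0 (fun s => forall p, In p l -> P s p).
Proof.
  induction l as [|x l IH]; intros H.
  - apply filter_forall. intros s p [].
  - generalize (filter_and _ _ (H x (or_introl eq_refl))
                  (IH (fun p Hp => H p (or_intror Hp)))).
    apply filter_imp. intros s [Hx Hl] p [<-|Hp]; auto.
Qed.

Lemma not_rotational_model (a : R * R) (r : R) :
  0 < r -> r ^ 4 * lor2 a a = -1 -> ~ rotational whole_plane (model a r).
Proof.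
  intros Hr Ha [p [d [Phi [Hd [[HM [Hplus [_ [[s0 [q0 Hmove]] Hfix]]]] Hinv]]]]].
  assert (Hp : forall s, Phi s p = p).
  { intros s. generalize (Hfix s 0).
    replace (add3 p (scal3 0 d)) with p; [trivial|].
    destruct p as [[? ?] ?]. unfold add3, scal3; cbn. repeat apply (f_equal2 pair); ring. }
  assert (HL : locally 0 (fun s => forall ty, In ty sample ->
            exists x v, model a r x v = Phi s (model a r (fst ty) (ln (snd ty))))).
  { apply locally_all_in. intros [t y] _.
    destruct (Hinv t (ln y) I) as [eps [He Hs]].
    exists (mkposreal eps He). intros s Hball.
    change (Rabs (s - 0) < eps) in Hball. rewrite Rminus_0_r in Hball.
    destruct (Hs s Hball) as [x [v [_ E]]]. exists x, v. exact E. }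
  destruct HL as [e He].
  assert (Small : forall s q, Rabs s < e -> Phi (s + s) q = q).
  { intros s q Hs.
    assert (Q := rigid_motion_phi_square a r (Phi s) Hr Ha (HM s)
      (fun t y Hin => He s ltac:(change (Rabs (s - 0) < e); rewrite Rminus_0_r; exact Hs)
                        (t, y) Hin)).
    apply (rigid_motion_phi_id a r (Phi (s + s)) p Ha (HM _) (Hp _)); intros x;
      rewrite Hplus; apply Q. }
  assert (Mult : forall s n q, Rabs s < e -> Phi (INR (S n) * (s + s)) q = q).
  { intros s n q Hs. induction n as [|n IH].
    - rewrite Rmult_1_l. apply Small, Hs.
    - rewrite S_INR, Rmult_plus_distr_r, Rmult_1_l, Hplus, (Small s q Hs). exact IH. }
  (* [s0] is a whole multiple of [s + s] with [s = s0 / (2 (n + 1))] smaller than [e], so [Phi s0]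
     is the identity, against [Hmove]. *)
  destruct (archimed_cor1 (e / (Rabs s0 + 1))) as [N [HN N0]].
  { apply Rdiv_lt_0_compat; [apply cond_pos|]. generalize (Rabs_pos s0). lra. }
  destruct N as [|n]; [inversion N0|].
  assert (PN : 0 < INR (S n)) by (apply lt_0_INR, N0).
  apply Hmove.
  replace s0 with (INR (S n) * (s0 / (2 * INR (S n)) + s0 / (2 * INR (S n))))
    by (field; lra).
  apply Mult. unfold Rdiv. rewrite Rabs_mult, Rabs_inv, Rabs_mult.
  rewrite (Rabs_pos_eq 2), (Rabs_pos_eq (INR (S n))) by lra.
  assert (B : / INR (S n) * (Rabs s0 + 1) < e).
  { apply (Rmult_lt_compat_r (Rabs s0 + 1)) in HN; [|generalize (Rabs_pos s0); lra].
    replace (e / (Rabs s0 + 1) * (Rabs s0 + 1)) with (pos e) in HN; [exact HN|].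
    field. generalize (Rabs_pos s0). lra. }
  rewrite Rinv_mult.
  assert (0 < / INR (S n)) by (apply Rinv_0_lt_compat, PN).
  generalize (Rabs_pos s0). intros. nra.
Qed.

Lemma Riemann_ZMC_example_model (a : R * R) (r : R) :
  0 < r -> r ^ 4 * lor2 a a = -1 -> Riemann_ZMC_example r whole_plane (model a r).
Proof.
  intros Hr Ha. split; [apply surface_model, Hr|]. split; [|split].
  - exists (0, 1, 0), (0, 0, 1), (fun x => scal3 x (ruling a r)).
    split; [apply standard_frame|]. intros x v _. apply model_circle.
  - apply ZMC_model, Ha.
  - apply not_rotational_model; assumption.
Qed.

(** * Causal character of the model *)

Lemma lor_ruling_dv (a : R * R) (r x v : R) :
  lor (ruling a r) (dv (model a r) x v) = r ^ 3 * lor2 a (cosh v, sinh v).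
Proof.
  rewrite dv_model. unfold lor2, lor, ruling, emb; cbn [x1 x2 x3 fst snd]. ring.
Qed.

Lemma lor_dv_dv (a : R * R) (r x v : R) :
  lor (dv (model a r) x v) (dv (model a r) x v) = r ^ 2.
Proof.
  rewrite dv_model. assert (C := cosh_sqr v).
  unfold lor; cbn [x1 x2 x3 fst snd]. ring [C].
Qed.

Lemma lor_sym (p q : L3) : lor p q = lor q p.
Proof. unfold lor. ring. Qed.

Lemma timelike_at_model (a : R * R) (r x v : R) :
  0 < r -> r ^ 4 * lor2 a a = -1 -> lor2 a (cosh v, sinh v) <> 0 ->
  timelike_at (model a r) x v.
Proof.
  intros Hr Ha Hv.
  assert (L0 : lor (ruling a r) (ruling a r) = 0) by (rewrite lor_ruling, Ha; ring).
  assert (F := lor_ruling_dv a r x v). assert (G := lor_dv_dv a r x v).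
  set (f := lor2 a (cosh v, sinh v)) in *.
  assert (U : du (model a r) x v = ruling a r) by (rewrite du_model; reflexivity).
  set (p := ruling a r) in *. set (q := dv (model a r) x v) in *.
  assert (B : forall k l k' l',
    lor (add3 (scal3 k p) (scal3 l q)) (add3 (scal3 k' p) (scal3 l' q)) =
    (k * l' + l * k') * (r ^ 3 * f) + l * l' * r ^ 2).
  { intros k l k' l'.
    rewrite lor_add3, !lor_scal3, (lor_sym p), (lor_sym q), !lor_add3, !lor_scal3.
    rewrite (lor_sym q p), L0, F, G. ring. }
  (* In the basis [p, q] the metric has entries [0], [r ^ 3 f] and [r ^ 2]. The first vector is
     [q / r]; adding [p / (r ^ 2 f)] to [- q / r] makes it orthogonal to the first and gives it
     square -1. *)
  exists (add3 (scal3 0 p) (scal3 (/ r) q)),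
    (add3 (scal3 (/ (r ^ 2 * f)) p) (scal3 (- / r) q)).
  split; [exists 0, (/ r); rewrite U; reflexivity|].
  split; [exists (/ (r ^ 2 * f)), (- / r); rewrite U; reflexivity|].
  assert (r <> 0) by lra.
  repeat split; rewrite B; field; auto.
Qed.

Lemma lightlike_at_model (a : R * R) (r x v : R) :
  r ^ 4 * lor2 a a = -1 -> lor2 a (cosh v, sinh v) = 0 ->
  lightlike_at (model a r) x v.
Proof.
  intros Ha Hv. exists (ruling a r). split; [|split].
  - exists 1, 0. rewrite du_model. unfold ruling, add3, scal3; cbn [x1 x2 x3 fst snd].
    repeat apply (f_equal2 pair); ring.
  - intros Z. apply (f_equal x1) in Z. unfold ruling, zero3 in Z; cbn in Z. lra.
  - intros w [k [l ->]].
    rewrite lor_sym, lor_add3, !lor_scal3, (lor_sym (dv _ _ _)), lor_ruling_dv, Hv, du_model,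
      lor_ruling, Ha. ring.
Qed.

(** Multiplied by [2 exp v], the equation becomes [m = n exp (2 v)]. The constraint gives [m n > 0],
    so there is exactly one solution [v], and the locus is the ruling over it. *)
Lemma lightlike_locus_model (a : R * R) (r : R) :
  0 < r -> r ^ 4 * lor2 a a = -1 ->
  lightlike_line (fun q => exists x v,
    lor2 a (cosh v, sinh v) = 0 /\ q = model a r x v).
Proof.
  intros Hr Ha.
  set (m := snd a + fst a). set (n := snd a - fst a).
  assert (MN : r ^ 4 * (m * n) = 1).
  { unfold lor2, lor, emb in Ha; cbn [x1 x2 x3 fst snd] in Ha. unfold m, n. lra. }
  assert (N0 : n <> 0) by (intros Z; rewrite Z in MN; lra).
  assert (Q : 0 < m / n).
  { assert (P : 0 < r ^ 4) by (apply pow_lt, Hr).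
    assert (0 < m * n) by nra.
    replace (m / n) with (m * n * / n ^ 2) by (field; exact N0).
    apply Rmult_lt_0_compat; [assumption|]. apply Rinv_0_lt_compat, pow2_gt_0, N0. }
  assert (E : forall v, 2 * exp v * lor2 a (cosh v, sinh v) = m - n * exp (2 * v)).
  { intros v. replace (2 * v) with (v + v) by ring. rewrite exp_plus.
    transitivity (m * (exp v * exp (- v)) - n * (exp v * exp v)).
    - rewrite exp_cosh_sinh, exp_opp_cosh_sinh. assert (C := cosh_sqr v).
      unfold lor2, lor, emb, m, n; cbn [x1 x2 x3 fst snd]. ring [C].
    - rewrite <- exp_plus, Rplus_opp_r, exp_0. ring. }
  assert (V : forall v, lor2 a (cosh v, sinh v) = 0 <-> v = ln (m / n) / 2).
  { intros v. specialize (E v). split; intros H.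
    - rewrite H in E.
      replace (m / n) with (exp (2 * v)); [rewrite ln_exp; field|].
      apply (Rmult_eq_reg_l n); [|exact N0]. field_simplify; [lra|exact N0].
    - replace (2 * v) with (ln (m / n)) in E by (rewrite H; field).
      rewrite exp_ln in E by exact Q.
      replace (m - n * (m / n)) with 0 in E by (field; exact N0).
      apply Rmult_integral in E. destruct E as [E|E]; [|exact E].
      generalize (exp_pos v). lra. }
  exists (model a r 0 (ln (m / n) / 2)), (ruling a r).
  assert (T : forall x v, model a r x v = add3 (model a r 0 v) (scal3 x (ruling a r))).
  { intros x v. unfold model, ruling, add3, scal3, emb; cbn [x1 x2 x3 fst snd].
    repeat apply (f_equal2 pair); ring. }
  split; [|split].
  - intros Z. apply (f_equal x1) in Z. unfold ruling, zero3 in Z; cbn in Z. lra.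
  - rewrite lor_ruling, Ha. ring.
  - intros q. split.
    + intros [x [v [H ->]]]. apply V in H. subst v. exists x. apply T.
    + intros [s ->]. exists s, (ln (m / n) / 2). split; [apply V; reflexivity|].
      symmetry. apply T.
Qed.

(** The function [xi] allows [X] to cover just a piece of the model with any regular parameter in
    place of [x]. The second clause determines the admissible [a]: those with lightlike rulings. *)
Theorem proposition4p1 :
  (forall (r : R) (D : R * R -> Prop) (X : R -> R -> L3),
     0 < r -> Riemann_ZMC_example r D X ->
     exists (Phi : L3 -> L3) (a : R * R) (xi : R -> R),
       rigid_motion Phi /\ a <> (0, 0) /\
       Riemann_ZMC_example r whole_plane (model a r) /\
       forall u v, D (u, v) ->
         ex_derive xi u /\ Derive xi u <> 0 /\
         Phi (X u v) = model a r (xi u) v) /\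
  (forall (r : R) (a : R * R),
     0 < r -> a <> (0, 0) ->
     (Riemann_ZMC_example r whole_plane (model a r) <->
      r ^ 4 * lor2 a a = -1)) /\
  (forall (r : R) (a : R * R),
     0 < r -> a <> (0, 0) ->
     Riemann_ZMC_example r whole_plane (model a r) ->
     (forall x v, lor2 a (cosh v, sinh v) <> 0 -> timelike_at (model a r) x v) /\
     (forall x v, lor2 a (cosh v, sinh v) = 0 -> lightlike_at (model a r) x v) /\
     lightlike_line (fun q => exists x v,
       lor2 a (cosh v, sinh v) = 0 /\ q = model a r x v)).

Proof.
  assert (Constraint : forall r a, 0 < r -> Riemann_ZMC_example r whole_plane (model a r) ->
                         r ^ 4 * lor2 a a = -1).
  { intros r a Hr [_ [_ [HZ _]]]. apply model_ZMC_constraint; assumption. }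
  assert (Nonzero : forall r a, r ^ 4 * lor2 a a = -1 -> a <> (0, 0)).
  { intros r a H ->. unfold lor2, lor, emb in H; cbn in H. lra. }
  split; [|split].
  - intros r D X Hr HX. destruct (classic (exists p, D p)) as [Hne|He].
    + destruct (Riemann_ZMC_example_is_model r D X Hr HX Hne)
        as [Phi [a [xi [HPhi [Ha H]]]]].
      exists Phi, a, xi. split; [exact HPhi|]. split; [exact (Nonzero r a Ha)|].
      split; [apply Riemann_ZMC_example_model; assumption|exact H].
    (* For an empty domain any admissible model will do; [a = (0, 1 / r ^ 2)] satisfies the
       constraint. *)
    + assert (Ha : r ^ 4 * lor2 (0, / r ^ 2) (0, / r ^ 2) = -1).
      { unfold lor2, lor, emb; cbn [x1 x2 x3 fst snd]. field. lra. }
      exists (fun q => add3 (frame_map (0, 1, 0) (0, 0, 1) q) zero3), (0, / r ^ 2), (fun x => x).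
      split; [apply rigid_motion_frame_map, standard_frame|].
      split; [exact (Nonzero r _ Ha)|].
      split; [apply Riemann_ZMC_example_model; assumption|].
      intros u v Hp. destruct He. exists (u, v). exact Hp.
  - intros r a Hr _. split; [apply Constraint, Hr|].
    apply Riemann_ZMC_example_model, Hr.
  - intros r a Hr _ HX. assert (Ha := Constraint r a Hr HX). split; [|split].
    + intros x v. apply timelike_at_model; assumption.
    + intros x v. apply lightlike_at_model; assumption.
    + apply lightlike_locus_model; assumption.
Qed.
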